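(* Let Assumptions (A0)--(A4) of the context hold and let $(\vec\rho_h^{\,k},\bm{u}_h^k)\in\Pi_\tau^1(\mathcal{V}_{h,+}^N\times\mathcal{X}_h^d)$, $(\vec\mu_h^{\,k},p_h^k)\in\Pi_\tau^0(\mathcal{V}_h^N\times\mathcal{Q}_h)$ be a solution to the numerical scheme (S1)--(S4) of the context. Then, for all $k=1,\ldots,n$: 1. (Pointwise constraint) $\sum_{i=1}^NV_i\rho_{h,i}^k(x)=1$ for all $x\in\Omega$. 2. (Pointwise bounds) $\rho_{h,i}^k\le V_i^{-1}$ for $i=1,\ldots,N$, and $V_{\rm max}^{-1}\le\rho_h^k\le V_{\rm min}^{-1}$, where $V_{\rm min}=\min\{V_1,\ldots,V_N\}$ and $V_{\rm max}=\max\{V_1,\ldots,V_N\}$. 3. (A priori estimates) $$\max_{k=1,\ldots,n}\Big(\|\bm{u}_h^k\|_{L^2(\Omega)}^2+\|(\rho_h^k)^{1/2}\bm{u}_h^k\|_{L^2(\Omega)}^2\Big)+\sum_{k=1}^n\tau\|\nabla\bm{u}_h^k\|_{L^2(\Omega)}^2\le C(E_h^0),$$ where $C(E_h^0)$ denotes a constant depending on the initial discrete energy, $E_h^0=\frac12\rho_h^0|\bm{u}_h^0|^2+f(\vec\rho_h^{\,0})$.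
   Context: Notation. $N\in\mathbb{N}$ is the number of components. Vectors in $\mathbb{R}^N$ are written $\vec v$, vectors in $\mathbb{R}^d$ are written $\bm v$. $\langle\cdot,\cdot\rangle$ is the $L^2(\Omega)$ inner product (of scalar, vector or matrix functions, the latter with the Frobenius product $:$). Assumptions. - (A0) $\Omega=(0,1)^d$, $d\ge1$, is topologically equivalent to the $d$-dimensional torus, i.e. periodic boundary conditions are enforced. - (A1) The mobility matrix $\mathbb{M}(\vec\rho)=(M_{ij}(\vec\rho))_{i,j=1}^N\in\mathbb{R}^{N\times N}$ is symmetric positive semi-definite with $(1,\ldots,1)^T\in\ker\mathbb{M}(\vec\rho)$. - (A2) The internal energy density $f:[0,\infty)^N\to\mathbb{R}$ is smooth and positively homogeneous of degree one, i.e. $f(\lambda\vec\rho)=\lambda f(\vec\rho)$ for all $\lambda>0$ and $\vec\rho\in[0,\infty)^N$. - (A3) The viscous stress tensor $\mathbb{S}:[0,\infty)^N\times\mathbb{R}^{d\times d}\to\mathbb{R}^{d\times d}$ satisfies $\mathbb{S}(\vec\rho,A):A\ge c_S|A|^2$ for all $A\in\mathbb{R}^{d\times d}$ and some $c_S>0$. - (A4) The initial data $\rho_i^0\ge0$ and $(\rho\bm u)^0$ are integrable functions, and $\sum_{i=1}^NV_i\rho_i^0=1$ in $\Omega$, where $V_i>0$ are constants (specific volumes), $i=1,\ldots,N$. This assumption is understood to include the constraint for the discrete initial densities, $\sum_{i=1}^NV_i\rho_{h,i}^0=1$ in $\Omega$. Discretization. $T>0$, $n\in\mathbb{N}$, $\tau=T/n$,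 $t_k=k\tau$. $\Pi_\tau^0(\mathcal U)$ (resp. $\Pi_\tau^1(\mathcal U)$) is the space of discontinuous piecewise constant (resp. continuous piecewise linear) functions on the time grid $\{t_0,\ldots,t_n\}$ with values in $\mathcal U$; the superscript $k$ denotes the value at time step $k$. $\mathcal{T}_h$ is a geometrically conforming partition of $\Omega$ into simplices that can be extended periodically to periodic extensions of $\Omega$, with maximal diameter $h>0$. $\mathcal{V}_h$ (resp. $\mathcal{X}_h$) is the space of (periodic) functions in $H^1(\Omega)\cap C^0(\overline\Omega)$ whose restriction to each $K\in\mathcal{T}_h$ is a polynomial of degree at most $1$ (resp. at most $2$). $\mathcal{Q}_h=\{v\in\mathcal{V}_h:\langle v,1\rangle=0\}$ and $\mathcal{V}_{h,+}=\{v\in\mathcal{V}_h:v(x)>0\text{ for }x\in\Omega\}$. Set $\bm{b}_{\rm skw}(\rho\bm{u};\bm{v},\bm{w})=\frac12\big(\langle(\rho\bm{u}\cdot\nabla)\bm{v},\bm{w}\rangle-\langle(\rho\bm{u}\cdot\nabla)\bm{w},\bm{v}\rangle\big)$ and $\rho_h^k=\sum_{i=1}^N\rho_{h,i}^k$. The starred densities $\vec\rho_h^{\,*}$, $\rho_h^*$ and velocity $\bm u_h^*$ are functions of the densities at steps $k,k+1$ and of $(\bm u_h^k,\bm u_h^{k+1})$, respectively (examples: the values at step $k$, the values at step $k+1$, or the mid-point rule). Scheme. Given initial data $(\vec\rho_h^{\,0},\bm{u}_h^0)\in\mathcal{V}_h^N\times\mathcal{X}_h^d$, a discrete solution satisfies,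 for $k=0,\ldots,n-1$, $i=1,\ldots,N$, and all $\psi_i,\xi_i\in\mathcal{V}_h$, $\bm v\in\mathcal{X}_h^d$, $q\in\mathcal{Q}_h$: (S1) $\frac1\tau\langle\rho_{h,i}^{k+1}-\rho_{h,i}^k,\psi_i\rangle-\langle\rho_{h,i}^k\bm{u}_h^{k+1},\nabla\psi_i\rangle+\sum_{j=1}^N\langle M_{ij}(\vec\rho_h^{\,*})\nabla\mu_{h,j}^{k+1},\nabla\psi_i\rangle=0$; (S2) $\langle\mu_{h,i}^{k+1},\xi_i\rangle-\big\langle\frac{\partial f}{\partial\rho_i}(\vec\rho_h^{\,k+1})+V_ip_h^{k+1},\xi_i\big\rangle=0$; (S3) $\frac{1}{2\tau}\langle\bm{u}_h^{k+1}(\rho_h^{k+1}-\rho_h^k),\bm v\rangle+\frac1\tau\langle\rho_h^k(\bm{u}_h^{k+1}-\bm{u}_h^k),\bm v\rangle+\bm{b}_{\rm skw}(\rho_h^*\bm{u}_h^*;\bm{u}_h^{k+1},\bm v)-\langle p_h^{k+1},\operatorname{div}\bm v\rangle+\langle\mathbb{S}(\vec\rho_h^{\,*},\nabla\bm{u}_h^{k+1}),\nabla\bm v\rangle+\sum_{i=1}^N\langle\rho_{h,i}^k\nabla(\mu_{h,i}^{k+1}-V_ip_h^{k+1}),\bm v\rangle=0$; (S4) $\langle\operatorname{div}\bm{u}_h^{k+1},q\rangle=-\sum_{i,j=1}^N\langle V_iM_{ij}(\vec\rho_h^{\,*})\nabla\mu_{h,j}^{k+1},\nabla q\rangle$. 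*)

(* Defs.v *)
From HB Require Import structures.
From mathcomp Require Import all_boot all_order all_algebra.
From mathcomp Require Import all_classical all_reals all_analysis.

Set Implicit Arguments.
Unset Strict Implicit.
Unset Printing Implicit Defensive.
Import Order.TTheory GRing.Theory Num.Theory.
Import numFieldNormedType.Exports.
Local Open Scope classical_set_scope.
Local Open Scope ring_scope.

(* Points of R^d and density vectors in R^N are row vectors.  Functions on the
   torus (0,1)^d are Z^d-periodic functions on R^d, and everything is
   integrated over the open cube. *)

Section Integration.
Context {R : realType}.
Implicit Types d : nat.

Definition Omega d : set 'rV[R]_d := [set x | forall j, 0 < x ord0 j < 1].
Definition Omega_bar d : set 'rV[R]_d := [set x | forall j, 0 <= x ord0 j <= 1].

Local Notation mR := (measurableTypeR R).

(* d-dimensional Lebesgue measure: the d-fold product of the measure on R. *)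
Fixpoint leb d : set (d.-tuple mR) -> \bar R :=
  match d with
  | 0 => \d_([tuple] : 0.-tuple mR)
  | d'.+1 => pushforward (product_measure1 (@lebesgue_measure R) (@leb d'))
               (fun y : mR * d'.-tuple mR => [tuple of y.1 :: y.2])
  end.

Lemma leb_is_sigma_finite_measure d :
  exists m : {sigma_finite_measure set (d.-tuple mR) -> \bar R}, @leb d = m.
Proof.
elim: d => [|d [m mE]].
  pose m0 : {sigma_finite_measure set (0.-tuple mR) -> \bar R} :=
    \d_([tuple] : 0.-tuple mR).
  by exists m0.
pose conc (y : mR * d.-tuple mR) : d.+1.-tuple mR := [tuple of y.1 :: y.2].
pose unc (t : d.+1.-tuple mR) : mR * d.-tuple mR :=
  (thead t, [tuple of behead t]).
have mconc : measurable_fun setT conc by exact: measurable_cons.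
have munc : measurable_fun setT unc.
  apply: measurable_fun_pair; first exact: measurable_tnth.
  exact: measurable_behead.
pose pm : {measure set (mR * d.-tuple mR) -> \bar R} :=
  product_measure1 (@lebesgue_measure R) m.
pose q : {measure set (d.+1.-tuple mR) -> \bar R} :=
  measure_function_pushforward__canonical__measure_function_Measure pm mconc.
have sf : sigma_finite setT q.
  have /sigma_finiteP[F [TF ndF Foo]] := sigma_finiteT (@lebesgue_measure R).
  have /sigma_finiteP[G [TG ndG Goo]] := sigma_finiteT m.
  exists (fun n => unc @^-1` (F n `*` G n)).
    rewrite -preimage_bigcup; apply/esym/seteqP; split=> // t _.
    have [i _ Fi] : (\bigcup_i F i) (unc t).1 by rewrite -TF.
    have [j _ Gj] : (\bigcup_i G i) (unc t).2 by rewrite -TG.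
    exists (maxn i j) => //; split.
    - by move: Fi; exact/subsetPset/ndF/leq_maxl.
    - by move: Gj; exact/subsetPset/ndG/leq_maxr.
  move=> n; have [mF Fn] := Foo n; have [mG Gn] := Goo n; split.
    rewrite -[X in measurable X]setTI; apply: munc => //.
    exact: measurableX.
  have -> : q (unc @^-1` (F n `*` G n)) = pm (F n `*` G n).
    have concK (y : mR * d.-tuple mR) : unc (conc y) = y.
      by case: y => x y; rewrite /unc /conc theadE; congr (_, _); exact: val_inj.
    rewrite /= /pushforward; congr (product_measure1 _ _ _).
    apply/funext => y.
    by rewrite -[LHS]/((F n `*` G n) (unc (conc y))) concK.
  by rewrite /= product_measure1E// lte_mul_pinfty// ge0_fin_numE.
pose sfq := Measure_isSigmaFinite.Build _ _ _ q sf.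
pose q' : {sigma_finite_measure set (d.+1.-tuple mR) -> \bar R} :=
  HB.pack (q : set (d.+1.-tuple mR) -> \bar R) (Measure.class q) sfq.
by exists q'; rewrite /= mE.
Qed.

Lemma leb0 d : @leb d set0 = 0%E.
Proof. by have [m ->] := leb_is_sigma_finite_measure d; exact: measure0. Qed.

Lemma leb_ge0 d A : (0 <= @leb d A)%E.
Proof. by have [m ->] := leb_is_sigma_finite_measure d; exact: measure_ge0. Qed.

Lemma leb_sigma_additive d : semi_sigma_additive (@leb d).
Proof.
by have [m ->] := leb_is_sigma_finite_measure d; exact: measure_semi_sigma_additive.
Qed.

HB.instance Definition _ d := isMeasure.Build _ _ _ (@leb d)
  (leb0 d) (@leb_ge0 d) (@leb_sigma_additive d).

Lemma leb_sigma_finite d : sigma_finite setT (@leb d).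
Proof.
by have [m ->] := leb_is_sigma_finite_measure d; exact: sigma_finiteT.
Qed.

HB.instance Definition _ d := Measure_isSigmaFinite.Build _ _ _ (@leb d)
  (leb_sigma_finite d).

Definition row_of d (t : d.-tuple mR) : 'rV[R]_d := \row_j tnth t j.

Definition int_Omega d (g : 'rV[R]_d -> R) : R :=
  \int[@leb d]_(t in @row_of d @^-1` @Omega d) g (row_of t).

Definition integrable_Omega d (g : 'rV[R]_d -> R) : Prop :=
  (@leb d).-integrable (@row_of d @^-1` @Omega d) (fun t => (g (row_of t))%:E).

(* Frobenius product; on row vectors, the Euclidean inner product. *)
Definition frob m n (A B : 'M[R]_(m, n)) : R := \sum_i \sum_j A i j * B i j.

Definition ip d (g h : 'rV[R]_d -> R) : R := int_Omega (fun x => g x * h x).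
Definition ipm d m n (G H : 'rV[R]_d -> 'M[R]_(m, n)) : R :=
  int_Omega (fun x => frob (G x) (H x)).
Definition L2sq d m n (G : 'rV[R]_d -> 'M[R]_(m, n)) : R := ipm G G.

Definition ip_defined d (g h : 'rV[R]_d -> R) : Prop :=
  integrable_Omega (fun x => g x * h x).
Definition ipm_defined d m n (G H : 'rV[R]_d -> 'M[R]_(m, n)) : Prop :=
  integrable_Omega (fun x => frob (G x) (H x)).

End Integration.

Section Differentiation.
Context {R : realType} {d : nat}.
Implicit Types (g : 'rV[R]_d -> R) (v w a : 'rV[R]_d -> 'rV[R]_d).

Definition partial n (j : 'I_n) (g : 'rV[R]_n -> R) (x : 'rV[R]_n) : R :=
  'D_(delta_mx ord0 j) g x.

(* The space derivatives below are only taken of continuous piecewise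
   polynomials, whose weak derivatives are the classical ones off the null set
   where these fail to exist. *)
Definition grad g (x : 'rV[R]_d) : 'rV[R]_d := \row_j partial j g x.

Definition Grad v (x : 'rV[R]_d) : 'M[R]_d :=
  \matrix_(i, j) partial j (fun y => v y ord0 i) x.

Definition dive v (x : 'rV[R]_d) : R :=
  \sum_j partial j (fun y => v y ord0 j) x.

(* (a . nabla) v *)
Definition advect a v (x : 'rV[R]_d) : 'rV[R]_d :=
  \row_i \sum_j a x ord0 j * partial j (fun y => v y ord0 i) x.

Definition b_skw a v w : R :=
  2^-1 * (ipm (advect a v) w - ipm (advect a w) v).

End Differentiation.

Section Mesh.
Context {R : realType} {d : nat}.

(* A simplex is given by the (d+1) x d matrix whose rows are its vertices. *)
Implicit Types K : 'M[R]_(d.+1, d).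

Definition edges K : 'M[R]_d :=
  \matrix_(i, j) (K (lift ord0 i) j - K ord0 j).

Definition face K (A : {set 'I_d.+1}) : set 'rV[R]_d :=
  [set x | exists l : 'rV[R]_d.+1,
    [/\ forall k, 0 <= l ord0 k, forall k, k \notin A -> l ord0 k = 0,
        \sum_k l ord0 k = 1 & x = l *m K]].

Definition simplex K : set 'rV[R]_d := face K [set: 'I_d.+1].

Definition int_vec (z : 'rV[int]_d) : 'rV[R]_d := map_mx intr z.

Definition translate_simplex (z : 'rV[int]_d) K : 'M[R]_(d.+1, d) :=
  \matrix_(k, j) (K k j + int_vec z ord0 j).

Definition diameter (A : set 'rV[R]_d) : R :=
  sup [set Num.sqrt (frob (y.1 - y.2) (y.1 - y.2)) | y in A `*` A].

(* Conformity is required of the whole Z^d-periodic family of translates: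
   two different members meet in a common proper face, which may be empty
   (A = set0).  Properness (at most d of the d+1 vertices) makes the interiors
   disjoint. *)
Record periodic_mesh (I : finType) (K : I -> 'M[R]_(d.+1, d)) (h : R) : Prop :=
  PeriodicMesh {
    mesh_nondegenerate : forall i, edges (K i) \in unitmx;
    mesh_cover : \bigcup_(i in [set: I]) simplex (K i) = @Omega_bar R d;
    mesh_conforming : forall (i i' : I) (z : 'rV[int]_d),
      i != i' \/ z != 0 ->
      exists A A' : {set 'I_d.+1},
        [/\ (#|A| <= d)%N, (#|A'| <= d)%N,
            simplex (translate_simplex z (K i)) `&` simplex (K i')
              = face (translate_simplex z (K i)) A
          & simplex (translate_simplex z (K i)) `&` simplex (K i')
              = face (K i') A'];
    mesh_size_gt0 : 0 < h;
    mesh_size : h = \big[Num.max/0]_i diameter (simplex (K i)) }.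

(* multivariate polynomial functions of total degree at most m *)
Definition poly_deg_le (m : nat) (p : 'rV[R]_d -> R) : Prop :=
  exists c : {ffun 'I_d -> 'I_m.+1} -> R,
  forall x, p x = \sum_(a : {ffun 'I_d -> 'I_m.+1} | (\sum_j a j <= m)%N)
                    c a * \prod_j x ord0 j ^+ a j.

Definition Zd_periodic (v : 'rV[R]_d -> R) : Prop :=
  forall (x : 'rV[R]_d) (z : 'rV[int]_d), v (x + int_vec z) = v x.

(* Membership in H^1 is automatic for continuous piecewise polynomials. *)
Definition FE (I : finType) (K : I -> 'M[R]_(d.+1, d)) (m : nat) :
    set ('rV[R]_d -> R) :=
  [set v | [/\ Zd_periodic v, continuous v
    & forall i, exists2 p, poly_deg_le m p
        & forall x, simplex (K i) x -> v x = p x]].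

Definition FEvec (I : finType) (K : I -> 'M[R]_(d.+1, d)) (m q : nat) :
    set ('rV[R]_d -> 'rV[R]_q) :=
  [set v | forall i, FE K m (fun x => v x ord0 i)].

Definition Vh (I : finType) (K : I -> 'M[R]_(d.+1, d)) := FE K 1.

Definition Qh (I : finType) (K : I -> 'M[R]_(d.+1, d)) :
    set ('rV[R]_d -> R) :=
  [set v | Vh K v /\ ip v (cst 1) = 0].

Definition VhN (N : nat) (I : finType) (K : I -> 'M[R]_(d.+1, d)) :=
  @FEvec I K 1 N.

Definition VhNplus (N : nat) (I : finType) (K : I -> 'M[R]_(d.+1, d)) :
    set ('rV[R]_d -> 'rV[R]_N) :=
  [set r | VhN K r /\ forall i x, @Omega R d x -> 0 < r x ord0 i].

Definition Xhd (I : finType) (K : I -> 'M[R]_(d.+1, d)) := @FEvec I K 2 d.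

End Mesh.
Arguments VhN {R d} N {I} K.
Arguments VhNplus {R d} N {I} K.

Section TimeGrid.
Context {R : realType}.

Definition step_size (T : R) (n : nat) : R := T / n%:R.
Definition tgrid (T : R) (n k : nat) : R := k%:R * step_size T n.

Definition Pi1 (E : lmodType R) (T : R) (n : nat) (U : set E) : set (R -> E) :=
  [set w | (forall t : R, 0 <= t <= T -> U (w t)) /\
    forall (k : nat) (t : R), (k < n)%N -> tgrid T n k <= t <= tgrid T n k.+1 ->
      w t = ((tgrid T n k.+1 - t) / step_size T n) *: w (tgrid T n k)
          + ((t - tgrid T n k) / step_size T n) *: w (tgrid T n k.+1)].

(* Values are attached to the intervals ]t_k, t_(k+1)], so that the value at
   step k+1 is the one taken on the interval ending at t_(k+1). *)
Definition Pi0 (E : Type) (T : R) (n : nat) (U : set E) : set (R -> E) :=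
  [set w | forall k, (k < n)%N -> U (w (tgrid T n k.+1)) /\
    forall t, tgrid T n k < t <= tgrid T n k.+1 -> w t = w (tgrid T n k.+1)].

End TimeGrid.

Section Model.
Context {R : realType} {d N : nat}.
Implicit Types (M : 'rV[R]_N -> 'M[R]_N) (f : 'rV[R]_N -> R)
  (S : 'rV[R]_N -> 'M[R]_d -> 'M[R]_d) (V : 'I_N -> R).

(* [0,oo)^N.  M, f and S are total functions, but are only ever constrained
   and evaluated for densities in this set. *)
Definition orthant : set 'rV[R]_N := [set r | forall i, 0 <= r ord0 i].
Definition open_orthant : set 'rV[R]_N := [set r | forall i, 0 < r ord0 i].

Definition mobility M : Prop := forall r, orthant r ->
  [/\ (M r)^T = M r,
      forall x : 'cV[R]_N, 0 <= (x^T *m M r *m x) ord0 ord0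
    & M r *m (const_mx 1 : 'cV[R]_N) = 0].

(* C^oo on an open set A: all iterated partial derivatives are
   differentiable on A. *)
Definition smooth_on (A : set 'rV[R]_N) f : Prop :=
  forall (s : seq 'I_N) (x : 'rV[R]_N), A x ->
    differentiable (foldr (@partial R N) f s) x.

Definition smooth_on_orthant f : Prop :=
  exists g : 'rV[R]_N -> R, smooth_on setT g /\ {in orthant, f =1 g}.

(* Smoothness up to the origin together with homogeneity of degree one forces
   f to be linear, hence convex, on the orthant.  The second alternative is
   therefore the more general one; it admits energies that are singular at the
   boundary, such as \sum_i r_i ln (r_i / \sum_j r_j), for which the decay of
   the discrete energy rests on convexity. *)
Definition internal_energy f : Prop :=
  (forall (l : R) (r : 'rV[R]_N), 0 < l -> orthant r -> f (l *: r) = l * f r) /\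
  (smooth_on_orthant f \/
   [/\ smooth_on open_orthant f, {within orthant, continuous f}
     & convex_function orthant f]).

Definition coercive_stress S : Prop :=
  exists cS : R, 0 < cS /\
    forall (r : 'rV[R]_N) (A : 'M[R]_d), orthant r ->
      cS * frob A A <= frob (S r A) A.

Definition total_density (r : 'rV[R]_d -> 'rV[R]_N) (x : 'rV[R]_d) : R :=
  \sum_i r x ord0 i.

Definition volume_constraint V (r : 'rV[R]_d -> 'rV[R]_N) : Prop :=
  forall x, @Omega R d x -> \sum_i V i * r x ord0 i = 1.

Definition initial_data V (r : 'rV[R]_d -> 'rV[R]_N) (m : 'rV[R]_d -> 'rV[R]_d) :
    Prop :=
  [/\ forall x, @Omega R d x -> orthant (r x),
      forall i, integrable_Omega (fun x => r x ord0 i),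
      forall j, integrable_Omega (fun x => m x ord0 j)
    & volume_constraint V r].

Definition Vmin (hN : (0 < N)%N) V : R :=
  \big[Num.min/V (Ordinal hN)]_i V i.
Definition Vmax (hN : (0 < N)%N) V : R :=
  \big[Num.max/V (Ordinal hN)]_i V i.

Definition energy f (r : 'rV[R]_d -> 'rV[R]_N) (u : 'rV[R]_d -> 'rV[R]_d) : R :=
  int_Omega (fun x => 2^-1 * total_density r x * frob (u x) (u x) + f (r x)).

(* The starred densities enter M and S, so they must take values in
   [0,oo)^N. *)
Definition preserves_nonneg
    (rstar : ('rV[R]_d -> 'rV[R]_N) -> ('rV[R]_d -> 'rV[R]_N) ->
             'rV[R]_d -> 'rV[R]_N) : Prop :=
  forall r0 r1, (forall x, @Omega R d x -> orthant (r0 x)) ->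
    (forall x, @Omega R d x -> orthant (r1 x)) ->
    forall x, @Omega R d x -> orthant (rstar r0 r1 x).

End Model.

Section Scheme.
Context {R : realType} {d N : nat}.
Variables (V : 'I_N -> R) (M : 'rV[R]_N -> 'M[R]_N) (f : 'rV[R]_N -> R)
  (S : 'rV[R]_N -> 'M[R]_d -> 'M[R]_d) (tau : R)
  (I : finType) (K : I -> 'M[R]_(d.+1, d)).

(* One time step, from (r0, u0) at step k to (r1, u1, mu, p) at step k+1;
   rs, ts and us are the starred density vector, total density and velocity.

   The integral of a non-integrable function is a meaningless value, and nothing
   is assumed about the measurability or growth of M, S, of the derivatives
   of f, or of the starred quantities.  The first five fields say that the
   pairings involving these are genuine Lebesgue integrals; all the other
   pairings are between bounded piecewise polynomials. *)
Record scheme_step (rs : 'rV[R]_d -> 'rV[R]_N) (ts : 'rV[R]_d -> R)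
    (us : 'rV[R]_d -> 'rV[R]_d)
    (r0 r1 : 'rV[R]_d -> 'rV[R]_N) (u0 u1 : 'rV[R]_d -> 'rV[R]_d)
    (mu : 'rV[R]_d -> 'rV[R]_N) (p : 'rV[R]_d -> R) : Prop := SchemeStep {
  mobility_defined : forall i j psi, Vh K psi ->
    ipm_defined (fun x => M (rs x) i j *: grad (fun y => mu y ord0 j) x)
                (grad psi);
  potential_defined : forall i xi, Vh K xi ->
    ip_defined (fun x => partial i f (r1 x)) xi;
  stress_defined : forall v, Xhd K v ->
    ipm_defined (fun x => S (rs x) (Grad u1 x)) (Grad v);
  advect1_defined : forall v, Xhd K v ->
    ipm_defined (advect (fun x => ts x *: us x) u1) v;
  advect2_defined : forall v, Xhd K v ->
    ipm_defined (advect (fun x => ts x *: us x) v) u1;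

  mass_balance : forall i psi, Vh K psi ->
    tau^-1 * ip (fun x => r1 x ord0 i - r0 x ord0 i) psi
    - ipm (fun x => r0 x ord0 i *: u1 x) (grad psi)
    + \sum_j ipm (fun x => M (rs x) i j *: grad (fun y => mu y ord0 j) x)
                 (grad psi) = 0;

  chemical_potential : forall i xi, Vh K xi ->
    ip (fun x => mu x ord0 i) xi
    - ip (fun x => partial i f (r1 x) + V i * p x) xi = 0;

  momentum_balance : forall v, Xhd K v ->
    (2 * tau)^-1 * ipm (fun x => (total_density r1 x - total_density r0 x) *: u1 x) v
    + tau^-1 * ipm (fun x => total_density r0 x *: (u1 x - u0 x)) v
    + b_skw (fun x => ts x *: us x) u1 v
    - ip p (dive v)
    + ipm (fun x => S (rs x) (Grad u1 x)) (Grad v)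
    + \sum_i ipm (fun x => r0 x ord0 i *:
                    grad (fun y => mu y ord0 i - V i * p y) x) v = 0;

  quasi_incompressibility : forall q, Qh K q ->
    ip (dive u1) q =
    - \sum_i \sum_j
        ipm (fun x => (V i * M (rs x) i j) *: grad (fun y => mu y ord0 j) x)
            (grad q) }.

(* rho and u are sampled at the grid points; mu and p at t_1, ..., t_n. *)
Definition discrete_solution (T : R) (n : nat)
    (rstar : ('rV[R]_d -> 'rV[R]_N) -> ('rV[R]_d -> 'rV[R]_N) ->
             'rV[R]_d -> 'rV[R]_N)
    (tstar : ('rV[R]_d -> 'rV[R]_N) -> ('rV[R]_d -> 'rV[R]_N) ->
             'rV[R]_d -> R)
    (ustar : ('rV[R]_d -> 'rV[R]_d) -> ('rV[R]_d -> 'rV[R]_d) ->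
             'rV[R]_d -> 'rV[R]_d)
    (rho : R -> 'rV[R]_d -> 'rV[R]_N) (u : R -> 'rV[R]_d -> 'rV[R]_d)
    (mu : R -> 'rV[R]_d -> 'rV[R]_N) (p : R -> 'rV[R]_d -> R) : Prop :=
  forall k, (k < n)%N ->
    let t0 := tgrid T n k in
    let t1 := tgrid T n k.+1 in
    scheme_step (rstar (rho t0) (rho t1)) (tstar (rho t0) (rho t1))
      (ustar (u t0) (u t1))
      (rho t0) (rho t1) (u t0) (u t1) (mu t1) (p t1).

End Scheme.

(* Main.v *)
(** Testing the mass balances with [V i * psi], summing, and testing the
    quasi-incompressibility with [psi] minus its mean gives
    [<sum_i V i (r1 i - r0 i), psi> = 0], once [<u, grad psi> = - <div u, psi>] is
    known; the choice [psi = sum_i V i r1 i - 1] then propagates the volume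
    constraint, which implies the pointwise bounds.  Testing with [u1], [mu i]
    and [r1 i - r0 i], the pressure cancels by the same integration by parts,
    and convexity of [f] along [r0], [r1] bounds the discrete energy.  A smooth
    [f] of degree one is linear on the orthant, hence convex as well.  The
    velocity bounds follow since [f] is bounded on the volume constraint set
    and [total_density >= 1 / Vmax].

    Integration by parts on the torus: a continuous periodic piecewise polynomial
    is Lipschitz, so its partial derivatives are bounded limits of difference
    quotients off the faces of the mesh, and every difference quotient has
    integral zero by translation invariance. *)

Require Import Defs.
From HB Require Import structures.
From mathcomp Require Import all_boot all_order all_algebra.
From mathcomp Require Import all_classical all_reals all_analysis.
From mathcomp Require Import measurable_realfun.
From mathcomp Require Import ring lra.
Set Implicit Arguments.
Unset Strict Implicit.
Unset Printing Implicit Defensive.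
Import Order.TTheory GRing.Theory Num.Theory.
Import numFieldNormedType.Exports.
Local Open Scope classical_set_scope.
Local Open Scope ring_scope.

(** Two obstacles shape the proof: measurability lives on tuples, not on row vectors, and the
    classical derivatives have meaningless values on mesh faces where they do not exist. Hence
    integrals are transferred to the [regular] points, the cube without the hyperplanes spanned by
    the faces. There each finite element function is locally a polynomial, so the product rule and
    linearity of the gradient hold pointwise, and the functions and their partial derivatives are
    bounded and measurable. Products of these are integrable since the cube has finite measure; for
    pairings with [M], [S] and the derivatives of [f], integrability is taken from the definedness
    fields of [scheme_step]. Both cancellations, of the fluxes and of the pressure, rest on the
    volume constraint of the old step, which collapses the weighted sum of the fluxes [r0 i * u1] to
    [u1]. The constraint is therefore propagated through all steps before any energy estimate. *)

(** * Translation on the line and on the circle *)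

Lemma lebesgue_measure_shift (R : realType) (s : R) (A : set (measurableTypeR R)) :
  measurable A ->
  lebesgue_measure A = pushforward lebesgue_measure (fun x : measurableTypeR R => x + s) A.
Proof.
move=> mA.
have ms : measurable_fun setT (fun x : measurableTypeR R => (x + s : measurableTypeR R)).
  by apply: measurable_funD.
pose q : {measure set (measurableTypeR R) -> \bar R} :=
  measure_function_pushforward__canonical__measure_function_Measure lebesgue_measure ms.
apply: (@lebesgue_measure_unique R q) => // X [[a b] _ <-].
rewrite /= /pushforward.
rewrite (_ : _ @^-1` _ = `]a - s, b - s]%classic); last first.
  by apply/seteqP; split=> x /=; rewrite !in_itv /= lerBrDr ltrBlDr.
rewrite !lebesgue_measure_itv /= !lte_fin ltrD2r; case: ifP => // _.
by rewrite -!EFinB; congr EFin; ring.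
Qed.

Section Lebesgue_translation.
Context {R : realType}.
Local Notation mR := (measurableTypeR R).
Local Notation mu := (@lebesgue_measure R).
Local Open Scope ereal_scope.

Lemma ge0_integral_shift (s : R) (A : set mR) (H : mR -> \bar R) :
  measurable A -> measurable_fun setT H -> (forall x, 0 <= H x) ->
  \int[mu]_(x in [set x | A (x + s)%R]) H (x + s)%R = \int[mu]_(x in A) H x.
Proof.
move=> mA mH H0.
have ms : measurable_fun setT (fun x : mR => (x + s)%R : mR).
  by apply: measurable_funD.
pose q : {measure set mR -> \bar R} :=
  measure_function_pushforward__canonical__measure_function_Measure mu ms.
have -> : \int[mu]_(x in A) H x = \int[q]_(x in A) H x.
  apply: eq_measure_integral => B mB _.
  exact: lebesgue_measure_shift.
rewrite ge0_integral_pushforward//.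
exact: measurable_funTS.
Qed.

(** The part of the shifted interval beyond 1 is moved back by one period onto []0, s[]. *)
Lemma integral_periodic_shift (s : R) (H : mR -> \bar R) : (0 <= s <= 1)%R ->
  measurable_fun setT H -> (forall x, 0 <= H x) ->
  (forall x, H (x + 1)%R = H x) ->
  \int[mu]_(x in `]0%R, 1%R[) H (x + s)%R = \int[mu]_(x in `]0%R, 1%R[) H x.
Proof.
move=> /andP[s0 s1] mH H0 Hper.
have mHT (D : set mR) : measurable_fun D H by exact: measurable_funTS.
have -> : \int[mu]_(x in `]0%R, 1%R[) H (x + s)%R =
          \int[mu]_(x in `]s, (1 + s)%R[) H x.
  rewrite -(ge0_integral_shift s _ mH)//; congr (integral _ _ _).
  by apply/seteqP; split=> x /=; rewrite !in_itv /= => /andP[a b]; apply/andP; split; lra.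
(* Endpoints are added, which changes no integral, so that both intervals split exactly into
   disjoint pieces. *)
rewrite -(integral_itv_bndoo true false (mHT _)).
rewrite -[RHS](integral_itv_bndoo true true (mHT _)).
have -> : `[s, (1 + s)%R]%classic = (`[s, 1%R[ `|` `[1%R, (1 + s)%R])%classic :> set mR.
  apply/seteqP; split=> x /=; rewrite !in_itv /=.
    by move=> /andP[a b]; case: (ltP x 1%R) => h; [left|right]; rewrite ?a ?b ?h.
  move=> [|] /andP[a b]; apply/andP; split => //; lra.
have -> : `[0%R, 1%R[%classic = (`[0%R, s[ `|` `[s, 1%R[)%classic :> set mR.
  apply/seteqP; split=> x /=; rewrite !in_itv /=.
    by move=> /andP[a b]; case: (ltP x s) => h; [left|right]; rewrite ?a ?b ?h.
  move=> [|] /andP[a b]; apply/andP; split => //; lra.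
rewrite ge0_integral_setU//; last first.
  by apply/disj_setPS => x /=; rewrite !in_itv /= => -[/andP[a b] /andP[c e]]; lra.
rewrite ge0_integral_setU//; last first.
  by apply/disj_setPS => x /=; rewrite !in_itv /= => -[/andP[a b] /andP[c e]]; lra.
rewrite addeC; congr (_ + _).
rewrite (integral_itv_bndoo true false (mHT _)) (integral_itv_bndoo true true (mHT _)).
rewrite -(ge0_integral_shift 1 _ mH)//.
have -> : [set x : mR | `]1%R, (1 + s)%R[%classic (x + 1)%R] = `]0%R, s[%classic.
  by apply/seteqP; split=> x /=; rewrite !in_itv /= => /andP[a b]; apply/andP; split; lra.
by apply: eq_integral => x _; exact: Hper.
Qed.

End Lebesgue_translation.

(** * Removing a null set from the domain of an arbitrary integrand *)

Section Null_modification.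
Local Open Scope ereal_scope.
Context d (T : measurableType d) (R : realType).
Variable mu : {measure set T -> \bar R}.
Import HBNNSimple.

(* The integral of a nonnegative function being a supremum over simple functions,
   no measurability of [f] is needed. *)
Lemma integral_setD_null (D N : set T) (f : T -> \bar R) :
  measurable N -> mu N = 0 ->
  \int[mu]_(x in D) f x = \int[mu]_(x in D `\` N) f x.
Proof.
move=> mN N0; rewrite /integral /=.
have key (h g : T -> \bar R) : (forall x, 0 <= g x) ->
    (forall x, ~ N x -> h x = g x) ->
    ereal_sup [set sintegral mu k | k in [set k : {nnsfun T >-> R} |
       forall x, (k x)%:E <= h x]] <=
    ereal_sup [set sintegral mu k | k in [set k : {nnsfun T >-> R} |
       forall x, (k x)%:E <= g x]].
  move=> g0 hg; apply: ge_ereal_sup => _ [k kh <-].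
  have mNC := measurableC mN.
  (* Multiplied by the indicator of the complement of [N], a simple function below [h] falls below
     [g], and its integral does not change. *)
  apply: ereal_sup_ubound => /=; exists (proj_nnsfun k mNC).
    move=> x /=; rewrite mindicE; have [xN|xN] := boolP (x \in ~` N).
      by rewrite mulr1 -hg//; exact: set_mem.
    by rewrite mulr0.
  rewrite -!integralT_nnsfun; apply: ae_eq_integral => //.
  - exact/measurable_EFinP/measurable_funP.
  - exact/measurable_EFinP/measurable_funP.
  exists N; split => // x /=; apply: contra_notP => xN _.
  by rewrite mindicE mem_set// mulr1.
have key2 (h g : T -> \bar R) : (forall x, 0 <= g x) -> (forall x, 0 <= h x) ->
    (forall x, ~ N x -> h x = g x) ->
    ereal_sup [set sintegral mu k | k in [set k : {nnsfun T >-> R} |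
       forall x, (k x)%:E <= h x]] =
    ereal_sup [set sintegral mu k | k in [set k : {nnsfun T >-> R} |
       forall x, (k x)%:E <= g x]].
  move=> g0 h0 hg; apply/eqP; rewrite eq_le !key// => x /hg //.
have E x : ~ N x -> (f \_ D) x = (f \_ (D `\` N)) x.
  by move=> xN; rewrite /patch in_setD (memNset xN) andbT.
congr (_ - _); apply: key2 => x.
- exact: funepos_ge0.
- exact: funepos_ge0.
- by move=> /E; rewrite !funeposE => ->.
- exact: funeneg_ge0.
- exact: funeneg_ge0.
- by move=> /E; rewrite !funenegE => ->.
Qed.

End Null_modification.

(** * Lebesgue measure on the unit cube, by induction on the dimension *)

Section Lebesgue_cube.
Context {R : realType}.
Local Notation mR := (measurableTypeR R).
Local Notation mu := (@lebesgue_measure R).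
Local Open Scope ereal_scope.

(** [Omega] read on tuples, where [leb] and its sigma-algebra live. *)
Definition tcube d : set (d.-tuple mR) := [set t | forall j, (0 < tnth t j < 1)%R].
Arguments tcube : clear implicits.

Definition tshift d (j : 'I_d) (s : R) (t : d.-tuple mR) : d.-tuple mR :=
  [tuple (tnth t i + (if i == j then s else 0))%R | i < d].

Lemma tshift0_cons d (s x : R) (t : d.-tuple mR) :
  tshift ord0 s [tuple of x :: t] = [tuple of (x + s)%R :: t].
Proof.
apply: eq_from_tnth => i; rewrite tnth_mktuple.
by case: (unliftP ord0 i) => [k|] ->; rewrite ?tnthS ?tnth0 //= addr0.
Qed.

Lemma tshiftS_cons d (j : 'I_d) (s x : R) (t : d.-tuple mR) :
  tshift (lift ord0 j) s [tuple of x :: t] = [tuple of x :: tshift j s t].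
Proof.
apply: eq_from_tnth => i; rewrite tnth_mktuple.
case: (unliftP ord0 i) => [k|] ->; rewrite ?tnthS ?tnth0 //= ?addr0//.
by rewrite tnth_mktuple (inj_eq (@lift_inj _ ord0)).
Qed.

Lemma measurable_tshift d (j : 'I_d) s : measurable_fun setT (tshift j s).
Proof.
apply/measurable_fun_tnthP => i.
have -> : (@tnth _ mR ^~ i) \o tshift j s =
    (fun t => tnth t i + (if i == j then s else 0))%R.
  by apply/funext => t /=; rewrite tnth_mktuple.
by apply: measurable_funD => //; exact: measurable_tnth.
Qed.

Lemma measurable_tcube d : measurable (tcube d).
Proof.
have -> : tcube d = \bigcap_(j in [set: 'I_d]) ((fun t => tnth t j) @^-1` `]0%R, 1%R[%classic).
  by apply/seteqP; split=> t /= h j; have := h j; rewrite /= in_itv /= => // /(_ I).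
apply: fin_bigcap_measurable => // j _; rewrite -[X in measurable X]setTI.
by apply: measurable_tnth => //; exact: measurable_itv.
Qed.

Lemma measurable_consT d : measurable_fun setT
  (fun y : mR * d.-tuple mR => [tuple of y.1 :: y.2] : d.+1.-tuple mR).
Proof. exact: measurable_cons. Qed.

Lemma tcube_cons d (x : R) (t : d.-tuple mR) :
  tcube d.+1 [tuple of x :: t] <-> (0 < x < 1)%R /\ tcube d t.
Proof.
split=> [h|[hx h] j].
  by split=> [|j]; [have := h ord0; rewrite tnth0|have := h (lift ord0 j); rewrite tnthS].
by case: (unliftP ord0 j) => [k|] ->; rewrite ?tnthS ?tnth0.
Qed.

Section cons.
Variables (d : nat) (F : d.+1.-tuple mR -> \bar R).
Hypotheses (mF : measurable_fun setT F) (F0 : forall t, 0 <= F t).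

Let FC (y : mR * d.-tuple mR) := (F \_ (tcube d.+1)) [tuple of y.1 :: y.2].
Let mFC : measurable_fun setT FC.
Proof.
apply: measurableT_comp; last exact: measurable_consT.
by apply/measurable_restrict => //; [exact: measurable_tcube|exact: measurable_funTS].
Qed.

(** [FC] is cut off in all coordinates, [G] only in the last [d]: the slice integral is then
    measurable on the whole line, as the one-dimensional shift requires. *)
Let G (y : mR * d.-tuple mR) := ((fun t => F [tuple of y.1 :: t]) \_ (tcube d)) y.2.
Let mG : measurable_fun setT G.
Proof.
have -> : G = (fun y => F [tuple of y.1 :: y.2]) \_ (setT `*` tcube d).
  apply/funext => -[x t]; rewrite /G /patch /=.
  congr (if _ then _ else _); apply/idP/idP; rewrite !inE /=; first by [].
  by case.
apply/measurable_restrict => //.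
  by apply: measurableX => //; exact: measurable_tcube.
by apply: measurable_funTS; apply: measurableT_comp => //; exact: measurable_consT.
Qed.

(** Tonelli for one step of the recursion defining [leb]; the inductions on the dimension for
    integrals over the cube go through it. *)
Lemma integral_tcube_cons :
  \int[@leb R d.+1]_(t in tcube d.+1) F t =
  \int[mu]_(x in `]0%R, 1%R[) \int[@leb R d]_(t in tcube d) F [tuple of x :: t].
Proof.
rewrite integral_mkcond.
transitivity (\int[pushforward (mu \x @leb R d)
   (fun y : mR * d.-tuple mR => [tuple of y.1 :: y.2] : d.+1.-tuple mR)]_t
     (F \_ (tcube d.+1)) t); first by [].
rewrite ge0_integral_pushforward//; last 3 first.
- exact: measurable_consT.
- by apply/measurable_restrict => //; [exact: measurable_tcube|exact: measurable_funTS].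
- by move=> t _; apply: erestrict_ge0 => // x _.
rewrite preimage_setT (fubini_tonelli1 _ mFC)//; last first.
  by move=> y; apply: erestrict_ge0 => // x _.
rewrite [RHS]integral_mkcond; apply: eq_integral => x _; rewrite /fubini_F /FC /=.
rewrite /patch /=; case: ifPn => [|/negP] xI.
  rewrite [RHS]integral_mkcond; apply: eq_integral => t _.
  rewrite /patch /=; congr (if _ then _ else _); apply/idP/idP; rewrite !inE.
    by move=> /tcube_cons[].
  by move=> h; apply/tcube_cons; split=> //; move: xI; rewrite inE /= in_itv.
rewrite integral0_eq// => t _; case: ifPn => //; rewrite inE => /tcube_cons[h _].
by case: xI; rewrite inE /= in_itv.
Qed.

Lemma measurable_integral_tcube_cons :
  measurable_fun setT (fun x : mR => \int[@leb R d]_(t in tcube d) F [tuple of x :: t]).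
Proof.
rewrite (_ : (fun x => _) = fubini_F (@leb R d) G).
  apply: measurable_fun_fubini_tonelli_F => //.
  by move=> y; apply: erestrict_ge0 => x _.
by apply/funext => x; rewrite integral_mkcond.
Qed.

End cons.

Lemma leb_tcube d : @leb R d (tcube d) = 1.
Proof.
elim: d => [|d IHd].
  by rewrite /= diracE mem_set// => -[].
rewrite -[LHS]mul1e -integral_cst; last exact: measurable_tcube.
rewrite (@integral_tcube_cons d (cst 1))//.
rewrite (eq_integral (fun=> 1)) => [|x _]; last first.
  rewrite integral_cst; last exact: measurable_tcube.
  by rewrite -[RHS]IHd mul1e.
rewrite integral_cst// mul1e.
have := @lebesgue_measure_itv R `]0%R, 1%R[.
by rewrite /= lte_fin ltr01 -EFinB subr0.
Qed.

(** Serves to show that a continuous function which is nonzero somewhere is not almost everywhere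
    zero. *)
Lemma leb_box_gt0 d (a b : 'I_d -> R) : (forall j, a j < b j)%R ->
  measurable [set t : d.-tuple mR | forall j, (a j < tnth t j < b j)%R] /\
  0 < @leb R d [set t | forall j, (a j < tnth t j < b j)%R].
Proof.
elim: d a b => [|d IHd] a b ab.
  rewrite (_ : [set t | _] = setT); last by apply/seteqP; split=> // t _ [].
  by split=> //; rewrite /= diracE mem_set ?lte01.
pose B := [set t : d.-tuple mR | forall j, a (lift ord0 j) < tnth t j < b (lift ord0 j)]%R.
have [mB B0] : measurable B /\ 0 < @leb R d B by exact: IHd.
have mE : measurable [set t : d.+1.-tuple mR | forall j, (a j < tnth t j < b j)%R].
  rewrite (_ : [set t | _] = \bigcap_(j in [set: 'I_d.+1])
      ((fun t => tnth t j) @^-1` `]a j, b j[%classic)); last first.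
    by apply/seteqP; split=> t /= h j; have := h j; rewrite /= in_itv /= => // /(_ I).
  apply: fin_bigcap_measurable => // j _; rewrite -[X in measurable X]setTI.
  by apply: measurable_tnth => //; exact: measurable_itv.
split=> //.
have -> : @leb R d.+1 [set t | forall j, (a j < tnth t j < b j)%R] =
    (mu \x @leb R d) (`]a ord0, b ord0[%classic `*` B).
  rewrite /= /pushforward; congr (product_measure1 _ _ _).
  apply/seteqP; split=> -[x t] /=.
    move=> h; split=> [|j]; first by have := h ord0; rewrite tnth0 in_itv.
    by have := h (lift ord0 j); rewrite tnthS.
  by move=> [hx h] j; case: (unliftP ord0 j) => [k|] ->; rewrite ?tnthS ?tnth0.
rewrite product_measure1E; [|exact: measurable_itv|exact: mB].
apply: mule_gt0 => //.
have := @lebesgue_measure_itv R `]a ord0, b ord0[.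
by rewrite /= lte_fin ab -EFinB => ->; rewrite lte_fin subr_gt0.
Qed.

(** A shift of the first coordinate is the periodic shift of the slice integral; a shift of a later
    one acts inside each slice, by induction. *)
Lemma integral_tcube_shift d (j : 'I_d) (s : R) (G : d.-tuple mR -> \bar R) :
  (0 <= s <= 1)%R -> measurable_fun setT G -> (forall t, 0 <= G t) ->
  (forall t, G (tshift j 1 t) = G t) ->
  \int[@leb R d]_(t in tcube d) G (tshift j s t) = \int[@leb R d]_(t in tcube d) G t.
Proof.
move=> s01; elim: d => [|d IHd] in j G *; first by case: j.
move=> mG G0 Gper.
rewrite !integral_tcube_cons//; last first.
  by apply: measurableT_comp => //; exact: measurable_tshift.
case: (unliftP ord0 j) Gper => [k|] -> Gper; last first.
  under eq_integral => x _ do under eq_integral => t _ do rewrite tshift0_cons.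
  apply: (@integral_periodic_shift R s
    (fun x => \int[@leb R d]_(t in tcube d) G [tuple of x :: t])) => //.
  - exact: measurable_integral_tcube_cons.
  - by move=> x; apply: integral_ge0.
  - by move=> x; apply: eq_integral => t _; rewrite -tshift0_cons Gper.
apply: eq_integral => x _.
under eq_integral => t _ do rewrite tshiftS_cons.
apply: (IHd k (fun t => G [tuple of x :: t])) => //.
  by apply: measurableT_comp => //; apply: measurable_cons.
by move=> t; rewrite -tshiftS_cons Gper.
Qed.

(** If a later coordinate has a nonzero coefficient, every slice is null by induction. Otherwise a
    slice is empty unless its first coordinate [x] solves [b + a ord0 * x = 0], which has at most
    one solution. *)
Lemma leb_affine_null d (a : 'I_d -> R) (b : R) :
  (b != 0%R \/ exists j, a j != 0%R) ->
  @leb R d (tcube d `&` [set t | \sum_j a j * tnth t j + b = 0]%R) = 0.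
Proof.
have maff n (c : 'I_n -> R) (e : R) :
    measurable [set t : n.-tuple mR | \sum_j c j * tnth t j + e = 0]%R.
  have mf : measurable_fun setT (fun t : n.-tuple mR => \sum_j c j * tnth t j + e : mR)%R.
    apply: measurable_funD => //; apply: measurable_sum => j.
    by apply: measurable_funM => //; exact: measurable_tnth.
  rewrite -[X in measurable X]setTI.
  by have := mf measurableT [set 0%R] (measurable_set1 _).
elim: d a b => [|d IHd] a b ab.
  rewrite (_ : _ `&` _ = set0) ?measure0//; apply/seteqP; split => // t [_ /=].
  rewrite big_ord0 add0r => b0; case: ab => [|[[]]//].
  by rewrite b0 eqxx.
set A := [set t : d.+1.-tuple mR | _].
have mA : measurable A by exact: maff.
have -> : @leb R d.+1 (tcube d.+1 `&` A) =
    \int[@leb R d.+1]_(t in tcube d.+1) (\1_A t)%:E.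
  rewrite integral_indic//; first by rewrite setIC.
  exact: measurable_tcube.
rewrite integral_tcube_cons//; last first.
  by apply/measurable_EFinP; exact: measurable_indic.
have E x (t : d.-tuple mR) : A [tuple of x :: t] =
    [set t | \sum_j a (lift ord0 j) * tnth t j + (b + a ord0 * x) = 0]%R t.
  rewrite /A /= big_ord_recl tnth0; congr (_ = _).
  rewrite (eq_bigr (fun k => a (lift ord0 k) * tnth t k)%R) => [|k _]; last by rewrite tnthS.
  by rewrite -addrA addrC -addrA.
have in_slice x : \int[@leb R d]_(t in tcube d) (\1_A [tuple of x :: t])%:E =
    @leb R d (tcube d `&`
      [set t | \sum_j a (lift ord0 j) * tnth t j + (b + a ord0 * x) = 0]%R).
  rewrite setIC -integral_indic; [|exact: measurable_tcube|exact: maff].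
  by apply: eq_integral => t _; rewrite !indicE; congr ((nat_of_bool _)%:R%:E); apply/idP/idP; rewrite !inE E.
under eq_integral do rewrite in_slice.
have [[k ak]|/forallNP a0] := pselect (exists k, a (lift ord0 k) != 0%R).
  by rewrite integral0_eq// => x _; rewrite IHd//; right; exists k.
pose N : set mR := [set x | b + a ord0 * x = 0]%R.
have mN : measurable N.
  rewrite -[X in measurable X]setTI.
  have : measurable_fun setT (fun x : mR => b + a ord0 * x : mR)%R.
    by apply: measurable_funD => //; apply: measurable_funM.
  by move=> /(_ measurableT [set 0%R] (measurable_set1 _)).
have N0 : mu N = 0.
  have [a00|a00] := eqVneq (a ord0) 0%R.
    rewrite (_ : N = set0) ?measure0//; apply/seteqP; split=> // x.
    rewrite /N /= a00 mul0r addr0 => b0; case: ab => [|[j]]; first by rewrite b0 eqxx.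
    by case: (unliftP ord0 j) => [k|] ->; [exact: a0|rewrite a00 eqxx].
  apply/eqP; rewrite eq_le measure_ge0 andbT.
  rewrite -(@lebesgue_measure_set1 R (- b / a ord0)%R).
  apply: le_measure; rewrite ?inE//.
  rewrite /N => x /= h; apply: (mulfI a00); rewrite mulrCA divff// mulr1.
  by apply/eqP; rewrite -addr_eq0 addrC h.
rewrite (integral_setD_null _ _ mN N0) integral0_eq// => x [_ xN].
by rewrite IHd//; left; apply/eqP.
Qed.

End Lebesgue_cube.
Arguments tcube {R} d.

(** * Measurability of continuous functions of vectors *)

Section Measurability_of_continuous_compositions.
Context {R : realType}.

(* Row vectors carry no sigma-algebra here: a continuous function of measurable
   coordinates is measured as the limit of its values on the grids of mesh
   [1 / n.+1], which [floor_row] maps into the orthant if its argument is. *)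
Definition floor_row N (n : nat) (r : 'rV[R]_N) : 'rV[R]_N :=
  \row_i ((Num.floor (n.+1%:R * r ord0 i))%:~R / n.+1%:R).

Lemma floor_row_ge0 N n (r : 'rV[R]_N) i : 0 <= r ord0 i -> 0 <= floor_row n r ord0 i.
Proof.
by move=> r0; rewrite mxE divr_ge0// ler0z floor_ge0 mulr_ge0.
Qed.

Lemma cvg_floor_row N (r : 'rV[R]_N) : floor_row n r @[n --> \oo] --> r.
Proof.
apply/cvg_ballP => e e0; near=> n; split=> // i j.
rewrite /ball /= (ord1 i) mxE.
have n0 : 0 < n.+1%:R :> R by rewrite ltr0n.
have /andP[h1 h2] := floor_itv (n.+1%:R * r ord0 j).
rewrite ger0_norm; last by rewrite subr_ge0 ler_pdivrMr// (mulrC (r _ _)).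
apply: (@le_lt_trans _ _ n.+1%:R^-1).
  rewrite -(ler_pM2l n0) mulrBr mulrCA divff ?gt_eqF// mulr1.
  by rewrite lerBlDl; move: h2; rewrite intrD => /ltW.
near: n; exact: near_infty_natSinv_lt (PosNum e0).
Unshelve. all: end_near. Qed.

(** [F] is arbitrary: [floor_row] takes values in a countable grid, and each cell of points sharing
    a grid value is measurable. *)
Lemma measurable_floor_row N d (T : measurableType d) (D : set T) (r : T -> 'rV[R]_N)
    (F : 'rV[R]_N -> R) n :
  (forall i, measurable_fun D (fun x => r x ord0 i)) ->
  measurable_fun D (fun x => F (floor_row n (r x))).
Proof.
move=> mr mD B mB.
pose cell (z : 'rV[int]_N) := D `&`
  \bigcap_(i in [set: 'I_N]) (D `&` (fun x => n.+1%:R * r x ord0 i) @^-1`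
     `[(z ord0 i)%:~R, (z ord0 i + 1)%:~R[%classic).
pose val (z : 'rV[int]_N) : 'rV[R]_N := \row_i ((z ord0 i)%:~R / n.+1%:R).
have mcell z : measurable (cell z).
  apply: measurableI => //; apply: fin_bigcap_measurable => // i _.
  by apply: (measurable_funM (measurable_cst _) (mr i)) => //; exact: measurable_itv.
have -> : D `&` (fun x => F (floor_row n (r x))) @^-1` B =
    \bigcup_(z : 'rV[int]_N) (if `[< B (F (val z)) >] then cell z else set0).
  apply/seteqP; split=> x.
    move=> [Dx Bx]; pose z := \row_i Num.floor (n.+1%:R * r x ord0 i).
    have zE : val z = floor_row n (r x) by apply/rowP => i; rewrite !mxE.
    exists z => //; rewrite zE asboolT//; split=> // i _; split=> //=.
    by rewrite in_itv /= mxE floor_itv.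
  move=> [z _]; case: ifPn => // /asboolP Bz [Dx h]; split=> //=.
  rewrite (_ : floor_row n (r x) = val z)//; apply/rowP => i; rewrite !mxE.
  congr (_%:~R / _); apply/eqP; rewrite floor_eq.
  by have [_] := h i I; rewrite /= in_itv.
apply: countable_bigcupT_measurable => [|z]; first exact: countableP.
by case: ifPn.
Qed.

Lemma measurable_comp_cvg N d (T : measurableType d) (D : set T) (r : T -> 'rV[R]_N)
    (F : 'rV[R]_N -> R) :
  (forall i, measurable_fun D (fun x => r x ord0 i)) ->
  (forall x, D x -> F (floor_row n (r x)) @[n --> \oo] --> F (r x)) ->
  measurable_fun D (fun x => F (r x)).
Proof.
move=> mr cF; apply: (@measurable_fun_cvg _ _ _ D (fun n x => F (floor_row n (r x)))).
  by move=> n; exact: measurable_floor_row.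
exact: cF.
Qed.

Lemma measurable_comp_continuous N d (T : measurableType d) (D : set T)
    (r : T -> 'rV[R]_N) (F : 'rV[R]_N -> R) :
  (forall i, measurable_fun D (fun x => r x ord0 i)) -> continuous F ->
  measurable_fun D (fun x => F (r x)).
Proof.
move=> mr cF; apply: measurable_comp_cvg => // x _.
by apply: continuous_cvg; [exact: cF|exact: cvg_floor_row].
Qed.

(** Meant for the internal energy, whose continuity is known only within the orthant; the grid
    approximations never leave it. *)
Lemma measurable_comp_orthant N d (T : measurableType d) (D : set T)
    (r : T -> 'rV[R]_N) (F : 'rV[R]_N -> R) :
  (forall i, measurable_fun D (fun x => r x ord0 i)) ->
  (forall x, D x -> orthant (r x)) ->
  {within @orthant R N, continuous F} ->
  measurable_fun D (fun x => F (r x)).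
Proof.
move=> mr r0 /subspace_continuousP cF; apply: measurable_comp_cvg => // x Dx.
have cFx := cF _ (r0 _ Dx); apply: cvg_trans cFx => A /=.
rewrite /within /nbhs /= => /cvg_floor_row [k _ hk]; exists k => // n /hk; apply.
by move=> i; apply: floor_row_ge0; exact: r0.
Qed.

End Measurability_of_continuous_compositions.

(** * Polynomial pieces: bounds and Lipschitz constants on the closed cube *)

Section Tame_functions.
Context {R : realType} {d : nat}.
Implicit Types (p q : 'rV[R]_d -> R).

(* What is needed of the polynomial pieces; unlike a degree bound, it is stable
   under products. *)
Definition tame p : Prop :=
  (forall x v, derivable p x v) /\
  exists B L, [/\ 0 <= B, 0 <= L, forall x, Omega_bar x -> `|p x| <= B &
    forall x y, Omega_bar x -> Omega_bar y -> `|p x - p y| <= L * `|x - y| ].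

Lemma tame_cst (c : R) : tame (fun=> c).
Proof.
split=> [x v|]; first exact: derivable_cst.
exists `|c|, 0; split=> // x y _ _; by rewrite subrr normr0 mul0r.
Qed.

Lemma norm_coord_le n (x : 'rV[R]_n) j : `|x ord0 j| <= `|x|.
Proof.
rewrite [leRHS]mx_normrE.
by apply: (@le_bigmax _ _ _ 0 (fun ij : 'I_1 * 'I_n => `|x ij.1 ij.2|) (ord0, j)).
Qed.

Lemma tame_coord (j : 'I_d) : tame (fun x => x ord0 j).
Proof.
split=> [x v|].
  apply/cvg_ex; exists (v ord0 j).
  apply: cvg_near_cst; near=> h.
  rewrite /= !mxE addrK /GRing.scale /= mulKf//.
  by near: h; exact: nbhs_dnbhs_neq.
exists 1, 1; split=> // [x hx|x y _ _].
  by have /andP[x0 x1] := hx j; rewrite ger0_norm.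
have -> : x ord0 j - y ord0 j = (x - y) ord0 j by rewrite !mxE.
by rewrite mul1r norm_coord_le.
Unshelve. all: end_near. Qed.

Lemma tameD p q : tame p -> tame q -> tame (fun x => p x + q x).
Proof.
move=> [dp [B [L [B0 L0 hB hL]]]] [dq [B' [L' [B0' L0' hB' hL']]]]; split.
  by move=> x v; exact: derivableD.
exists (B + B'), (L + L'); split; rewrite ?addr_ge0//.
  move=> x hx; by rewrite (le_trans (ler_normD _ _))// lerD// ?hB// hB'.
move=> x y hx hy; rewrite opprD addrACA mulrDl (le_trans (ler_normD _ _))//.
by rewrite lerD// ?hL// hL'.
Qed.

Lemma tameM p q : tame p -> tame q -> tame (fun x => p x * q x).
Proof.
move=> [dp [B [L [B0 L0 hB hL]]]] [dq [B' [L' [B0' L0' hB' hL']]]]; split.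
  by move=> x v; exact: derivableM.
exists (B * B'), (B * L' + B' * L); split;
  rewrite ?addr_ge0 ?mulr_ge0//.
  move=> x hx; by rewrite normrM ler_pM// ?hB// hB'.
move=> x y hx hy; have -> : p x * q x - p y * q y = p x * (q x - q y) + q y * (p x - p y) by ring.
rewrite mulrDl -!mulrA (le_trans (ler_normD _ _))// !normrM.
by rewrite lerD// ler_pM// ?hB ?hB' ?hL ?hL'.
Qed.

Lemma tame_sum (I : Type) (s : seq I) (P : pred I) (p : I -> 'rV[R]_d -> R) :
  (forall i, tame (p i)) -> tame (fun x => \sum_(i <- s | P i) p i x).
Proof.
move=> hp; elim: s => [|i s IH].
  by under eq_fun do rewrite big_nil; exact: tame_cst.
under eq_fun do rewrite big_cons.
by case: (P i) => //; exact: tameD.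
Qed.

Lemma tame_prod (I : Type) (s : seq I) (P : pred I) (p : I -> 'rV[R]_d -> R) :
  (forall i, tame (p i)) -> tame (fun x => \prod_(i <- s | P i) p i x).
Proof.
move=> hp; elim: s => [|i s IH].
  by under eq_fun do rewrite big_nil; exact: tame_cst.
under eq_fun do rewrite big_cons.
by case: (P i) => //; exact: tameM.
Qed.

Lemma tameX p n : tame p -> tame (fun x => p x ^+ n).
Proof.
move=> hp; elim: n => [|n IH]; first by under eq_fun do rewrite expr0; exact: tame_cst.
by under eq_fun do rewrite exprS; exact: tameM.
Qed.

Lemma tame_poly m p : poly_deg_le m p -> tame p.
Proof.
move=> [c pE]; have -> : p = fun x => \sum_(a : {ffun 'I_d -> 'I_m.+1} |
  (\sum_j a j <= m)%N) c a * \prod_j x ord0 j ^+ a j by apply/funext.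
apply: tame_sum => a; apply: tameM; first exact: tame_cst.
by apply: tame_prod => j; apply: tameX; exact: tame_coord.
Qed.

End Tame_functions.

(** * Linear structure of the finite element spaces *)

Section Polynomial_spaces.
Context {R : realType} {d m : nat}.
Implicit Types (p q : 'rV[R]_d -> R).

Lemma poly_deg_le_lin (a : R) p q : poly_deg_le m p -> poly_deg_le m q ->
  poly_deg_le m (fun x => a * p x + q x).
Proof.
move=> [c pE] [e qE]; exists (fun k => a * c k + e k) => x.
rewrite pE qE mulr_sumr -big_split /=; apply: eq_bigr => k _.
by rewrite mulrDl mulrA.
Qed.

Lemma poly_deg_le_cst (c : R) : poly_deg_le m (fun _ : 'rV[R]_d => c).
Proof.
pose a0 : {ffun 'I_d -> 'I_m.+1} := [ffun=> ord0].
exists (fun a => if a == a0 then c else 0) => x.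
rewrite (bigD1 a0) /=; last by rewrite big1// => j _; rewrite ffunE.
rewrite eqxx [X in _ * X]big1 ?mulr1 => [|j _]; last by rewrite ffunE expr0.
rewrite big1 ?addr0// => a /andP[_ /negbTE ->]; by rewrite mul0r.
Qed.

Variables (I : finType) (K : I -> 'M[R]_(d.+1, d)).

Lemma FE_lin (a : R) v w : FE K m v -> FE K m w -> FE K m (fun x => a * v x + w x).
Proof.
move=> [v1 v2 v3] [w1 w2 w3]; split.
- by move=> x z; rewrite v1 w1.
- by move=> x; exact: (cvgD (cvgM (cvg_cst a) (v2 x)) (w2 x)).
- move=> i; have [p pm pE] := v3 i; have [q qm qE] := w3 i.
  exists (fun x => a * p x + q x); first exact: poly_deg_le_lin.
  by move=> x hx; rewrite pE// qE.
Qed.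

Lemma FE_cst (c : R) : FE K m (fun=> c).
Proof.
split=> [//||i]; first exact: cst_continuous.
exists (fun=> c) => //; exact: poly_deg_le_cst.
Qed.

Lemma FED v w : FE K m v -> FE K m w -> FE K m (fun x => v x + w x).
Proof.
move=> hv hw; have := FE_lin 1 hv hw.
by under eq_fun do rewrite mul1r.
Qed.

Lemma FEZ (a : R) v : FE K m v -> FE K m (fun x => a * v x).
Proof.
move=> hv; have := FE_lin a hv (FE_cst 0).
by under eq_fun do rewrite addr0.
Qed.

Lemma FEB v w : FE K m v -> FE K m w -> FE K m (fun x => v x - w x).
Proof.
move=> hv hw; have := FE_lin (-1) hw hv.
by under eq_fun do rewrite mulN1r addrC.
Qed.

Lemma FE_sum (J : Type) (s : seq J) (P : pred J) (v : J -> 'rV[R]_d -> R) :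
  (forall i, FE K m (v i)) -> FE K m (fun x => \sum_(i <- s | P i) v i x).
Proof.
move=> hp; elim: s => [|i s IH].
  by under eq_fun do rewrite big_nil; exact: FE_cst.
under eq_fun do rewrite big_cons.
by case: (P i) => //; exact: FED.
Qed.

End Polynomial_spaces.

(** * Barycentric coordinates of a nondegenerate simplex *)

Section Barycentric_coordinates.
Context {R : realType} {d : nat}.
Implicit Types (K : 'M[R]_(d.+1, d)) (x : 'rV[R]_d).

(** Solving relative to vertex 0 only requires inverting the square matrix [edges K]; the weight of
    vertex 0 is the complement to one. *)
Definition bary K (k : 'I_d.+1) x : R :=
  let l := (x - row ord0 K) *m invmx (edges K) in
  if unlift ord0 k is Some i then l ord0 i else 1 - \sum_i l ord0 i.

Lemma bary0 K x : bary K ord0 x = 1 - \sum_i bary K (lift ord0 i) x.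
Proof.
rewrite {1}/bary unlift_none; congr (_ - _).
by apply: eq_bigr => i _; rewrite /bary liftK.
Qed.

Lemma sum_bary K x : \sum_k bary K k x = 1.
Proof. by rewrite big_ord_recl bary0 subrK. Qed.

Lemma row_edges K i : row i (edges K) = row (lift ord0 i) K - row ord0 K.
Proof. by apply/rowP => j; rewrite !mxE. Qed.

Lemma baryE K x : edges K \in unitmx -> x = (\row_k bary K k x) *m K.
Proof.
move=> uK; rewrite mulmx_sum_row big_ord_recl mxE bary0 scalerBl scale1r scaler_suml.
under [X in _ + X]eq_bigr do rewrite mxE.
rewrite -addrA [X in _ + X]addrC -sumrB.
apply/eqP; rewrite addrC -subr_eq; apply/eqP.
rewrite -[LHS](mulmxKV uK) mulmx_sum_row; apply: eq_bigr => i _.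
by rewrite row_edges scalerBr /bary liftK.
Qed.

Lemma bary_uniq K x (l : 'rV[R]_d.+1) k : edges K \in unitmx ->
  \sum_k l ord0 k = 1 -> x = l *m K -> bary K k x = l ord0 k.
Proof.
move=> uK l1 xE.
have xE' : x - row ord0 K = (\row_i l ord0 (lift ord0 i)) *m edges K.
  have l0 : l ord0 ord0 = 1 - \sum_i l ord0 (lift ord0 i).
    by rewrite -l1 big_ord_recl addrK.
  rewrite xE !mulmx_sum_row big_ord_recl l0 scalerBl scale1r scaler_suml.
  rewrite addrC addrA addrA addNr add0r addrC -sumrB; apply: eq_bigr => i _.
  by rewrite row_edges scalerBr !mxE.
have lift_eq i : bary K (lift ord0 i) x = l ord0 (lift ord0 i).
  by rewrite /bary liftK xE' mulmxK// mxE.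
case: (unliftP ord0 k) => [i|] ->; first exact: lift_eq.
rewrite bary0; under eq_bigr do rewrite lift_eq.
by rewrite -l1 big_ord_recl addrK.
Qed.

Lemma bary_vertex K k : edges K \in unitmx -> bary K k (row k K) = 1.
Proof.
move=> uK; rewrite (@bary_uniq K _ (delta_mx ord0 k))// ?mxE ?eqxx//.
  rewrite (bigD1 k)//= mxE !eqxx big1 ?addr0// => i ik.
  by rewrite mxE (negbTE ik) andbF.
by rewrite rowE.
Qed.

(** Nontriviality comes from the value 1 at vertex [k]; it makes the zero set a hyperplane or empty,
    hence null. *)
Lemma bary_affine K k : edges K \in unitmx ->
  exists (a : 'I_d -> R) (b : R), (b != 0 \/ exists j, a j != 0) /\
    forall x, bary K k x = \sum_j a j * x ord0 j + b.
Proof.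
move=> uK.
have [a [b ab]] : exists (a : 'I_d -> R) (b : R),
    forall x, bary K k x = \sum_j a j * x ord0 j + b.
  have lE x i : bary K (lift ord0 i) x = \sum_j invmx (edges K) j i * x ord0 j
      - (row ord0 K *m invmx (edges K)) ord0 i.
    rewrite /bary liftK mulmxBl !mxE; congr (_ - _).
    by apply: eq_bigr => j _; rewrite mulrC.
  case: (unliftP ord0 k) => [i|] ->.
    exists (fun j => invmx (edges K) j i), (- (row ord0 K *m invmx (edges K)) ord0 i).
    by move=> x; rewrite lE.
  exists (fun j => - \sum_i invmx (edges K) j i),
    (1 + \sum_i (row ord0 K *m invmx (edges K)) ord0 i).
  move=> x; rewrite bary0; under eq_bigr do rewrite lE.
  rewrite sumrB exchange_big /= opprB addrA addrC; congr (_ + _).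
  by rewrite -sumrN; apply: eq_bigr => j _; rewrite mulNr mulr_suml.
exists a, b; split=> //.
have [b0|b0] := eqVneq b 0; [right|by left].
apply: contrapT => /forallNP a0.
have := bary_vertex k uK; rewrite ab b0 addr0 big1 => [/esym/eqP|j _].
  by rewrite oner_eq0.
by have /negP := a0 j; rewrite negbK => /eqP ->; rewrite mul0r.
Qed.

Lemma simplexP K x : edges K \in unitmx ->
  simplex K x <-> forall k, 0 <= bary K k x.
Proof.
move=> uK; split=> [[l [l0 _ l1 xE]] k|h].
  by rewrite (bary_uniq _ uK l1 xE).
exists (\row_k bary K k x); split.
- by move=> k; rewrite mxE.
- by move=> k; rewrite inE.
- by rewrite -[RHS](sum_bary K x); apply: eq_bigr => k _; rewrite mxE.
- exact: baryE.
Qed.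

Lemma bary_continuous K k : edges K \in unitmx -> continuous (bary K k).
Proof.
move=> uK; have [a [b [_ E]]] := bary_affine k uK.
have -> : bary K k = fun x => \sum_j a j * x ord0 j + b by apply/funext.
have cs (s : seq 'I_d) : continuous (fun x : 'rV[R]_d => \sum_(j <- s) a j * x ord0 j).
  elim: s => [|j s IH] x.
    by under eq_fun do rewrite big_nil; exact: cst_continuous.
  under eq_fun do rewrite big_cons.
  exact: (cvgD (cvgM (cvg_cst (a j)) (@coord_continuous _ _ _ ord0 j x)) (IH x)).
move=> x; exact: (cvgD (cs _ x) (cvg_cst b)).
Qed.

End Barycentric_coordinates.

(** * Points off the mesh hyperplanes *)

Section Regular_points.
Context {R : realType} {d : nat} (I : finType) (K : I -> 'M[R]_(d.+1, d)) (h : R).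
Hypothesis pm : periodic_mesh K h.
Local Notation mR := (measurableTypeR R).

Let uK i : edges (K i) \in unitmx. Proof. exact: mesh_nondegenerate pm i. Qed.

(* Every function of the finite element spaces is a polynomial near each of
   these points, which avoid the hyperplanes spanned by the mesh faces. *)
Definition regular : set 'rV[R]_d :=
  [set x | Omega x /\ forall i k, bary (K i) k x != 0].

(* The finitely many simplices being closed, [y] near [x] lies only in those
   that contain [x]. *)
Lemma near_simplex_closed x :
  \forall y \near x, forall i, simplex (K i) y -> simplex (K i) x.
Proof.
have key i : \forall y \near x, simplex (K i) y -> simplex (K i) x.
  have [|nx] := pselect (simplex (K i) x); first by move=> hx; near=> y.
  have [k kx] : exists k, bary (K i) k x < 0.
    apply: contrapT => /forallNP hk; apply: nx; apply/simplexP => // k.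
    by rewrite leNgt; apply/negP/hk.
  have : \forall y \near x, bary (K i) k y < 0.
    have := @bary_continuous _ _ (K i) k (uK i) x.
    by move=> /(_ [set z | z < 0]); apply; exact: lt_nbhsl.
  apply: filterS => y ky /simplexP -/(_ (uK i) k).
  by rewrite leNgt ky.
exact: (@filter_forall _ _ _ (nbhs x) _ key).
Unshelve. all: end_near. Qed.

Lemma Omega_sub_bar x : @Omega R d x -> Omega_bar x.
Proof. by move=> hx j; have /andP[a b] := hx j; rewrite !ltW. Qed.

Lemma mesh_simplex x : Omega_bar x -> exists i, simplex (K i) x.
Proof. by rewrite -(mesh_cover pm) => -[i _ hi]; exists i. Qed.

(** In a simplex containing a regular point, all barycentric coordinates of the point are
    nonnegative and nonzero, hence positive, which is an open condition. *)
Lemma near_simplex_regular x : regular x ->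
  exists i, simplex (K i) x /\ \forall y \near x, simplex (K i) y.
Proof.
move=> [Ox rx]; have [i xi] := mesh_simplex (Omega_sub_bar Ox).
exists i; split=> //.
have pos k : 0 < bary (K i) k x.
  by rewrite lt_neqAle eq_sym rx /=; move/simplexP : xi; exact.
have near_pos k : \forall y \near x, 0 < bary (K i) k y.
  have := @bary_continuous _ _ (K i) k (uK i) x.
  by move=> /(_ [set z | 0 < z]); apply; exact: lt_nbhsr.
have near_all : \forall y \near x, forall k, 0 < bary (K i) k y.
  exact: (@filter_forall _ _ _ (nbhs x) _ near_pos).
by apply: filterS near_all => y hy; apply/simplexP => // k; exact: ltW.
Qed.

Let bad (ik : I * 'I_d.+1) : set (d.-tuple mR) :=
  tcube d `&` [set t | bary (K ik.1) ik.2 (row_of t) = 0].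

Lemma tcubeE : tcube d = @row_of R d @^-1` @Omega R d.
Proof.
by apply/seteqP; split=> t ht j; have := ht j; rewrite !mxE.
Qed.

Let measurable_bad ik : measurable (bad ik).
Proof.
apply: measurableI; first exact: measurable_tcube.
rewrite -[X in measurable X]setTI.
have : measurable_fun setT (fun t : d.-tuple mR => bary (K ik.1) ik.2 (row_of t)).
  apply: measurable_comp_continuous; last exact: bary_continuous.
  by move=> i; under eq_fun do rewrite mxE; exact: measurable_tnth.
by move=> /(_ measurableT [set 0] (measurable_set1 _)).
Qed.

Let bad_null ik : @leb R d (bad ik) = 0%E.
Proof.
have [a [b [ab E]]] := bary_affine ik.2 (uK ik.1).
rewrite -[RHS](leb_affine_null ab); congr (leb (_ `&` _)).
have S (t : d.-tuple mR) : \sum_j a j * row_of t ord0 j = \sum_j a j * tnth t j.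
  by apply: eq_bigr => j _; rewrite mxE.
by apply/seteqP; split=> t /=; rewrite E S.
Qed.

Let Bad := \bigcup_(ik in [set: I * 'I_d.+1]) bad ik.

Lemma regular_preimageE : @row_of R d @^-1` regular = tcube d `\` Bad.
Proof.
apply/seteqP; split=> t.
  move=> [Ot rt]; split; first by rewrite tcubeE.
  by move=> [ik _ [_ /eqP]]; rewrite (negbTE (rt _ _)).
move=> [Ct Bt]; split; first by move: Ct; rewrite tcubeE.
by move=> i k; apply/eqP => ik0; apply: Bt; exists (i, k).
Qed.

Let measurable_Bad : measurable Bad.
Proof. by apply: fin_bigcup_measurable. Qed.

Lemma regular_preimage_sub : @row_of R d @^-1` regular `<=` tcube d.
Proof. by rewrite regular_preimageE => t []. Qed.

Lemma measurable_regular : measurable (@row_of R d @^-1` regular).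
Proof.
by rewrite regular_preimageE; apply: measurableD => //; exact: measurable_tcube.
Qed.

Let Bad_null : @leb R d Bad = 0%E.
Proof.
apply/eqP; rewrite eq_le measure_ge0 andbT.
have fT : finite_set [set: I * 'I_d.+1] by [].
have := @content_sub_fsum _ _ _ (@leb R d) _ [set: I * 'I_d.+1] Bad bad fT
  (fun ik _ => measurable_bad ik) measurable_Bad (@subset_refl _ Bad).
by move=> /le_trans; apply; rewrite fsbig1// => ik _; exact: bad_null.
Qed.

Lemma regular_null : exists N : set (d.-tuple mR),
  [/\ measurable N, @leb R d N = 0%E & tcube d `\` N = @row_of R d @^-1` regular].
Proof. by exists Bad; rewrite -regular_preimageE. Qed.

(** Valid for every [g], measurable or not, so any integrand may be altered freely on the mesh
    faces. *)
Lemma int_OmegaE (g : 'rV[R]_d -> R) :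
  int_Omega g = \int[@leb R d]_(t in @row_of R d @^-1` regular) g (row_of t).
Proof.
rewrite /int_Omega /Rintegral; congr fine; rewrite -tcubeE regular_preimageE.
exact: integral_setD_null.
Qed.

End Regular_points.

(** * Global bounds for continuous periodic piecewise functions *)

(** The supremum of the times up to which the estimate from 0 holds is attained, and were it below 1
    the local estimate would carry it further. This handles segments crossing many simplices without
    listing the crossings. *)
Lemma locally_lipschitz_le {R : realType} (phi : R -> R) (C : R) : 0 <= C ->
  (forall s : R, 0 <= s <= 1 -> exists2 e : R, 0 < e & forall s' : R, 0 <= s' <= 1 ->
     `|s' - s| < e -> `|phi s' - phi s| <= C * `|s' - s|) ->
  `|phi 1 - phi 0| <= C.
Proof.
move=> C0 hphi.
pose S : set R := [set s | 0 <= s <= 1 /\ `|phi s - phi 0| <= C * s].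
have S0 : S 0 by split; rewrite ?lexx ?ler01// subrr normr0 mulr0.
have hS : has_sup S.
  by split; [exists 0|exists 1 => s [/andP[]]].
have c0 : 0 <= sup S by apply: (ub_le_sup hS.2).
have c1 : sup S <= 1 by apply: ge_sup => [|s [/andP[]]//]; exists 0.
have [e e0 he] := hphi (sup S) ltac:(by rewrite c0 c1).
have Sc : S (sup S).
  have [s1 Ss1 cs1] := sup_adherent e0 hS.
  have s1c : s1 <= sup S by apply: (ub_le_sup hS.2).
  have [/andP[s10 s11] hs1] := Ss1.
  split; first by rewrite c0 c1.
  have := he s1; rewrite s10 s11 => /(_ isT).
  rewrite (distrC s1) (distrC (phi s1)) (@ger0_norm _ (sup S - s1)) ?subr_ge0//.
  move=> /(_ ltac:(lra)) h.
  have -> : phi (sup S) - phi 0 = (phi (sup S) - phi s1) + (phi s1 - phi 0) by ring.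
  rewrite (le_trans (ler_normD _ _))// (_ : C * sup S = C * (sup S - s1) + C * s1).
    exact: lerD.
  by ring.
suff -> : 1 = sup S by rewrite (le_trans Sc.2)// ler_piMr.
apply/eqP; rewrite eq_le c1 andbT leNgt; apply/negP => cl1.
pose s := Num.min (sup S + e / 2) 1.
have cs : sup S < s by rewrite lt_min cl1 andbT ltrDl divr_gt0.
have s1 : s <= 1 by rewrite ge_min lexx orbT.
have se : s - sup S < e.
  have : s <= sup S + e / 2 by rewrite ge_min lexx.
  lra.
suff : s <= sup S by rewrite leNgt cs.
apply: (ub_le_sup hS.2); split; first by rewrite s1 andbT; lra.
have := he s; rewrite s1 andbT (le_trans c0 (ltW cs)) => /(_ isT).
have sn : 0 <= s - sup S by lra.
rewrite (ger0_norm sn) => /(_ se) h.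
have -> : phi s - phi 0 = (phi s - phi (sup S)) + (phi (sup S) - phi 0) by ring.
rewrite (le_trans (ler_normD _ _))// (_ : C * s = C * (s - sup S) + C * sup S).
  exact: lerD Sc.2.
by ring.
Qed.

Section Piecewise_tame_functions.
Context {R : realType} {d : nat} (I : finType) (K : I -> 'M[R]_(d.+1, d)) (h : R).
Hypothesis pm : periodic_mesh K h.
Local Notation mR := (measurableTypeR R).
Local Notation D := (@row_of R d @^-1` regular K).
Implicit Types (g : 'rV[R]_d -> R).

Definition piecewise_tame g : Prop :=
  [/\ Zd_periodic g, continuous g & forall i, exists2 p, tame p &
      forall x, simplex (K i) x -> g x = p x].
Local Notation PW := piecewise_tame.

Lemma FE_piecewise_tame m g : FE K m g -> PW g.
Proof.
move=> [g1 g2 g3]; split=> // i; have [p pm' pE] := g3 i.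
by exists p => //; exact: tame_poly pm'.
Qed.

Lemma piecewise_tameM g1 g2 : PW g1 -> PW g2 -> PW (fun x => g1 x * g2 x).
Proof.
move=> [a1 a2 a3] [b1 b2 b3]; split.
- by move=> x z; rewrite a1 b1.
- by move=> x; exact: (cvgM (a2 x) (b2 x)).
- move=> i; have [p tp pE] := a3 i; have [q tq qE] := b3 i.
  by exists (fun x => p x * q x); [exact: tameM|move=> x hx; rewrite pE// qE].
Qed.

Lemma piecewise_tame_bounded g : PW g -> exists2 B, 0 <= B & forall x, `|g x| <= B.
Proof.
move=> [gper _ gp].
have /choice[B hB] : forall i, exists B, 0 <= B /\
    forall x, Omega_bar x -> simplex (K i) x -> `|g x| <= B.
  move=> i; have [p [_ [B [L [B0 _ hB _]]]] pE] := gp i.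
  by exists B; split=> // x Ox xi; rewrite pE// hB.
exists (\sum_i B i); first by apply: sumr_ge0 => i _; have [] := hB i.
move=> x; pose z : 'rV[int]_d := \row_j - Num.floor (x ord0 j).
rewrite -(gper x z).
have Oz : Omega_bar (x + int_vec z).
  move=> j; rewrite !mxE mulrNz subr_ge0.
  have /andP[-> h2] := floor_itv (x ord0 j).
  by move: h2; rewrite intrD lerBlDl => /ltW.
have [i xi] := mesh_simplex pm Oz.
rewrite (le_trans ((hB i).2 _ Oz xi))//.
by rewrite (bigD1 i)//= lerDl; apply: sumr_ge0 => k _; have [] := hB k.
Qed.

(** On the segment from [y] to [x], every point close to [z s] shares a simplex with [z s], so a
    local constant applies and [locally_lipschitz_le] makes the estimate global. The sum of the
    local constants dominates each of them. *)
Lemma piecewise_tame_lipschitz_bar g : PW g -> exists2 L, 0 <= L &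
  forall x y, Omega_bar x -> Omega_bar y -> `|g x - g y| <= L * `|x - y|.
Proof.
move=> [gper _ gp].
have /choice[L hL] : forall i, exists L, 0 <= L /\
    forall x y, Omega_bar x -> Omega_bar y -> simplex (K i) x -> simplex (K i) y ->
    `|g x - g y| <= L * `|x - y|.
  move=> i; have [p [_ [B [L [_ L0 _ hL]]]] pE] := gp i.
  by exists L; split=> // x y Ox Oy xi yi; rewrite !pE// hL.
have L0 : 0 <= \sum_i L i by apply: sumr_ge0 => i _; have [] := hL i.
exists (\sum_i L i) => // x y Ox Oy.
pose z (s : R) := y + s *: (x - y).
suff : `|g (z 1) - g (z 0)| <= (\sum_i L i) * `|x - y|.
  by rewrite /z scale1r scale0r addr0 (addrC y) subrK.
have Oz s : 0 <= s <= 1 -> Omega_bar (z s).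
  move=> /andP[s0 s1] j; have /andP[x0 x1] := Ox j; have /andP[y0 y1] := Oy j.
  by rewrite !mxE; apply/andP; split; nra.
have dz s s' : z s' - z s = (s' - s) *: (x - y).
  by rewrite /z opprD addrACA subrr add0r scalerBl.
apply: (@locally_lipschitz_le R (fun s => g (z s))).
  by rewrite mulr_ge0.
move=> s s01.
have /nbhs_normP[e /= e0 he] := near_simplex_closed pm (z s).
have M0 : 0 < `|x - y| + 1 by rewrite ltr_wpDl.
(* The added 1 keeps the radius positive when [x = y]. *)
exists (e / (`|x - y| + 1)); first by rewrite divr_gt0.
move=> s' s'01 ss'.
have [i zi] := mesh_simplex pm (Oz _ s'01).
have zi' : simplex (K i) (z s).
  apply: (he (z s')) => //; rewrite /ball_ /= distrC dz mx_normZ.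
  move: ss'; rewrite ltr_pdivlMr// => ss'.
  apply: le_lt_trans ss'; rewrite ler_wpM2l// lerDl//.
have [Li0 hLi] := hL i.
rewrite (le_trans (hLi _ _ (Oz _ s'01) (Oz _ s01) zi zi'))//.
rewrite dz mx_normZ mulrCA [leRHS]mulrC ler_wpM2l//.
rewrite ler_wpM2r//.
by rewrite (bigD1 i)//= lerDl; apply: sumr_ge0 => k _; have [] := hL k.
Qed.

End Piecewise_tame_functions.

(** * Difference quotients and vanishing integrals of derivatives on the torus *)

Lemma cvg_derive_seq (R : realType) n (f : 'rV[R]_n -> R) (r w : 'rV[R]_n) : derivable f r w ->
  k.+1%:R * (f (r + k.+1%:R^-1 *: w) - f r) @[k --> \oo] --> 'D_w f r.
Proof.
move=> df.
have cv : (k.+1%:R^-1 : R) @[k --> \oo] --> (0 : R)^'.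
  move=> A A0; have : nbhs (0 : R) (fun y => y != 0 -> A y) by exact: A0.
  move=> /(@cvg_harmonic R) hA.
  have {}hA : \forall k \near \oo, harmonic k != 0 :> R -> A (harmonic k) by exact: hA.
  by apply: (filterS _ hA) => k; apply; rewrite /harmonic /= invr_eq0 pnatr_eq0.
have := cvg_comp _ _ cv df.
rewrite (_ : _ \o _ = fun k : nat => k.+1%:R * (f (r + k.+1%:R^-1 *: w) - f r))//.
by apply/funext => k; rewrite /= invrK [X in f X]addrC.
Qed.

Section Integration_by_parts.
Context {R : realType} {d : nat} (I : finType) (K : I -> 'M[R]_(d.+1, d)) (h : R).
Hypothesis pm : periodic_mesh K h.
Local Notation mR := (measurableTypeR R).
Local Notation D := (@row_of R d @^-1` regular K).
Local Notation PW := (piecewise_tame K).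
Implicit Types (g : 'rV[R]_d -> R).

Lemma int_vec_delta (j : 'I_d) (x : 'rV[R]_d) :
  x + int_vec (delta_mx ord0 j) = x + delta_mx ord0 j.
Proof. by rewrite /int_vec map_delta_mx. Qed.

Lemma norm_delta_le (j : 'I_d) : `|delta_mx ord0 j : 'rV[R]_d| <= 1.
Proof.
rewrite [leLHS]mx_normrE; apply: bigmax_le => // -[i k] _ /=.
by rewrite mxE; case: (_ && _); rewrite ?normr1 ?normr0.
Qed.

(** The shifted point may leave the cube; periodicity then replaces the path by two pieces inside
    the closed cube whose lengths add up to [s]. *)
Lemma piecewise_tame_lipschitz g (j : 'I_d) : PW g -> exists2 L : R, 0 <= L &
  forall x s, Omega x -> 0 <= s <= 1 ->
    `|g (x + s *: delta_mx ord0 j) - g x| <= L * s.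
Proof.
move=> gP; have [gper _ _] := gP.
have [L L0 hL] := piecewise_tame_lipschitz_bar pm gP.
exists L => // x s Ox /andP[s0 s1].
set e : 'rV[R]_d := delta_mx ord0 j.
have hle (a b : R) : Omega_bar (x + a *: e) -> Omega_bar (x + b *: e) -> b <= a ->
    `|g (x + a *: e) - g (x + b *: e)| <= L * (a - b).
  move=> Oa Ob ab; rewrite (le_trans (hL _ _ Oa Ob))// ler_wpM2l//.
  rewrite opprD addrACA subrr add0r -scalerBl mx_normZ ger0_norm ?subr_ge0//.
  by rewrite ler_piMr ?subr_ge0// norm_delta_le.
have Obar a : 0 <= x ord0 j + a <= 1 -> Omega_bar (x + a *: e).
  move=> ha k; rewrite !mxE eqxx /=; have [->|kj] := eqVneq k j; first by rewrite mulr1.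
  by rewrite mulr0 addr0; have /andP[/ltW -> /ltW ->] := Ox k.
have /andP[xj0 xj1] := Ox j.
have O0 : Omega_bar (x + 0 *: e) by apply: Obar; lra.
have x0 : x + 0 *: e = x by rewrite scale0r addr0.
have [le1|gt1] := leP (x ord0 j + s) 1.
  rewrite -{2}x0 -[X in _ <= _ * X]subr0; apply: hle => //; apply: Obar; lra.
(* Shifting [x] by [b] reaches the face where coordinate [j] is 0, by [b + 1] the opposite one; [g]
   agrees at these two points. *)
pose b := - x ord0 j.
have shift1 a : g (x + (a + 1) *: e) = g (x + a *: e).
  by rewrite scalerDl scale1r addrA -int_vec_delta gper.
have E : g (x + s *: e) - g x =
    (g (x + (s - 1) *: e) - g (x + b *: e)) + (g (x + (b + 1) *: e) - g (x + 0 *: e)).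
  by rewrite shift1 -(shift1 (s - 1)) subrK x0; ring.
rewrite E (le_trans (ler_normD _ _))//.
have -> : L * s = L * ((s - 1) - b) + L * ((b + 1) - 0) by rewrite /b; ring.
by apply: lerD; apply: hle => //; rewrite /b; (try apply: Obar); lra.
Qed.

Lemma piecewise_tame_derivable g x v : PW g -> regular K x -> derivable g x v.
Proof.
move=> [_ _ gp] rx; have [i [_ near_i]] := near_simplex_regular pm rx.
have [p [dp _] pE] := gp i.
apply: (@near_eq_derivable _ _ _ p); last exact: dp.
by apply: filterS near_i => y /pE ->.
Qed.

Definition diffq (j : 'I_d) g (n : nat) x : R :=
  n.+1%:R * (g (x + n.+1%:R^-1 *: delta_mx ord0 j) - g x).

Lemma cvg_diffq g j x : PW g -> regular K x ->
  diffq j g n x @[n --> \oo] --> partial j g x.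
Proof.
by move=> gP rx; exact/cvg_derive_seq/piecewise_tame_derivable.
Qed.

Lemma measurable_row_of (j : 'I_d) : measurable_fun setT (fun t : d.-tuple mR => row_of t ord0 j).
Proof. by under eq_fun do rewrite mxE; exact: measurable_tnth. Qed.

Lemma row_of_tshift (j : 'I_d) s (t : d.-tuple mR) :
  row_of (tshift j s t) = row_of t + s *: delta_mx ord0 j.
Proof.
apply/rowP => i; rewrite !mxE tnth_mktuple eqxx /=; congr (_ + _).
by case: (i == j); rewrite ?mulr1 ?mulr0.
Qed.

Lemma measurable_row_of_shift g (v : 'rV[R]_d) (E : set (d.-tuple mR)) :
  continuous g -> measurable_fun E (fun t => g (row_of t + v)).
Proof.
move=> cg; apply: measurable_funTS.
apply: (@measurable_comp_continuous _ _ _ _ _ (fun t => row_of t + v) g) => // i.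
under eq_fun do rewrite mxE.
by apply: measurable_funD => //; exact: measurable_row_of.
Qed.

(** Closed under products, which integrability alone is not; as [D] has finite measure, it yields
    integrability of all pairings of finite element functions and their derivatives. *)
Definition bmeasurable g : Prop :=
  measurable_fun D (fun t => g (row_of t)) /\
  exists B, forall x, regular K x -> `|g x| <= B.

Lemma finite_regular : (@leb R d D < +oo)%E.
Proof.
apply: (@le_lt_trans _ _ (@leb R d (tcube d))); last by rewrite leb_tcube ltry.
apply: le_measure; rewrite ?inE.
- exact: measurable_regular pm.
- exact: measurable_tcube.
- exact: regular_preimage_sub.
Qed.

Lemma bmeasurable_integrable g : bmeasurable g -> (@leb R d).-integrable D (fun t => (g (row_of t))%:E).
Proof.
move=> [mg [B hB]]; apply: measurable_bounded_integrable => //.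
- exact: measurable_regular pm.
- exact: finite_regular.
- exists B; split; first by rewrite num_real.
  by move=> b Bb t Dt; rewrite /= (le_trans (hB _ Dt))// ltW.
Qed.

Lemma bmeasurable_piecewise_tame g : PW g -> bmeasurable g.
Proof.
move=> gP; have [_ cg _] := gP; split.
  by have := @measurable_row_of_shift g 0 D cg; under eq_fun do rewrite addr0.
by have [B _ hB] := piecewise_tame_bounded pm gP; exists B => x _; exact: hB.
Qed.

Lemma diffq_le g j : PW g -> exists2 L : R, 0 <= L &
  forall n x, Omega x -> `|diffq j g n x| <= L.
Proof.
move=> gP; have [L L0 hL] := piecewise_tame_lipschitz j gP.
exists L => // n x Ox; have n0 : 0 < n.+1%:R :> R by rewrite ltr0n.
rewrite /diffq normrM gtr0_norm// mulrC -ler_pdivlMr//.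
by apply: hL => //; rewrite invr_ge0 ltW//= invf_le1// ler1n.
Qed.

Lemma bmeasurable_partial g j : PW g -> bmeasurable (partial j g).
Proof.
move=> gP; have [_ cg _] := gP; have [L L0 hL] := diffq_le j gP.
split.
  apply: (@measurable_fun_cvg _ _ _ D (fun n t => diffq j g n (row_of t))).
    move=> n; apply: measurable_funM => //; apply: measurable_funB.
      exact: measurable_row_of_shift.
    by have := @measurable_row_of_shift g 0 D cg; under eq_fun do rewrite addr0.
  by move=> t Dt; exact: cvg_diffq.
exists L => x rx.
have cv : `|diffq j g n x| @[n --> \oo] --> `|partial j g x|.
  by apply: cvg_norm; exact: cvg_diffq.
rewrite -(cvg_lim _ cv)//; apply: limr_le; first by apply/cvg_ex; eexists; exact: cv.
by apply: nearW => n; apply: hL; case: rx.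
Qed.

Lemma integral_torus_shift g j (s : R) : PW g -> 0 <= s <= 1 ->
  \int[@leb R d]_(t in D) g (row_of t + s *: delta_mx ord0 j) =
  \int[@leb R d]_(t in D) g (row_of t).
Proof.
move=> gP s01; have [gper cg _] := gP; have [B B0 hB] := piecewise_tame_bounded pm gP.
have mD := measurable_regular pm.
have bnd_int (v : 'rV[R]_d) :
    (@leb R d).-integrable D (fun t => (g (row_of t + v))%:E).
  apply: (bmeasurable_integrable (g := fun x => g (x + v))); split.
    exact: measurable_row_of_shift.
  by exists B.
have cst_int : (@leb R d).-integrable D (fun=> B%:E).
  by apply: (bmeasurable_integrable (g := fun=> B)); split=> //; exists `|B|.
(* Adding the bound [B] makes the integrand nonnegative, as the Tonelli argument for shifts
   requires; its integral is subtracted at the end. *)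
pose G (t : d.-tuple mR) : \bar R := (g (row_of t) + B)%:E.
have G0 t : (0 <= G t)%E.
  by rewrite lee_fin -lerBlDr sub0r; have /ler_normlP[] := hB (row_of t); lra.
have mG : measurable_fun setT G.
  apply/measurable_EFinP; apply: measurable_funD => //.
  by have := @measurable_row_of_shift g 0 setT cg; under eq_fun do rewrite addr0.
have Gper t : G (tshift j 1 t) = G t.
  by rewrite /G row_of_tshift scale1r -int_vec_delta gper.
have := integral_tcube_shift s01 mG G0 Gper.
(* The regular points need not be invariant under shifts, so the shift is performed over the whole
   cube. *)
have toD (F : d.-tuple mR -> \bar R) :
    (\int[@leb R d]_(t in tcube d) F t = \int[@leb R d]_(t in D) F t)%E.
  have [N [mN N0 DE]] := regular_null pm.
  by rewrite (integral_setD_null _ _ mN N0) DE.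
rewrite !toD => /(congr1 fine).
under [X in fine X = _]eq_integral do rewrite /G row_of_tshift.
rewrite -/(Rintegral _ _ _) -[RHS]/(Rintegral _ _ (fun t => g (row_of t) + B)) => E.
have i0 : (@leb R d).-integrable D (fun t => (g (row_of t))%:E).
  by have := bnd_int 0; under eq_fun do rewrite addr0.
have := E; rewrite (RintegralD mD (bnd_int _) cst_int) (RintegralD mD i0 cst_int).
exact: addIr.
Qed.

Lemma int_partial g j : PW g -> int_Omega (partial j g) = 0.
Proof.
move=> gP; rewrite (int_OmegaE pm).
have mD := measurable_regular pm.
have [L L0 hL] := diffq_le j gP.
have [_ cg _] := gP.
have := @dominated_convergence _ _ _ (@leb R d) D mD
  (fun n t => (diffq j g n (row_of t))%:E) (fun t => (partial j g (row_of t))%:E)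
  (fun=> L%:E).
case.
- move=> n; apply/measurable_EFinP; apply: measurable_funM => //; apply: measurable_funB.
    exact: measurable_row_of_shift.
  by have := @measurable_row_of_shift g 0 D cg; under eq_fun do rewrite addr0.
- by apply/measurable_EFinP; have [] := bmeasurable_partial j gP.
- by apply: aeW => t Dt; apply: cvg_EFin; [exact: nearW|exact: cvg_diffq].
- by apply: (bmeasurable_integrable (g := fun=> L)); split=> //; exists `|L|.
- by apply: aeW => t n Dt; rewrite /= lee_fin hL//; case: Dt.
move=> _ _ cv; rewrite /Rintegral -(cvg_lim _ cv)//.
rewrite (_ : (fun n => _) = cst 0%E) ?lim_cst//.
apply/funext => n /=.
have [_ [B hB]] := bmeasurable_piecewise_tame gP.
have i0 : (@leb R d).-integrable D (fun t => (g (row_of t))%:E).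
  exact: bmeasurable_integrable (bmeasurable_piecewise_tame gP).
have i1 : (@leb R d).-integrable D
    (fun t => (g (row_of t + n.+1%:R^-1 *: delta_mx ord0 j))%:E).
  apply: (bmeasurable_integrable (g := fun x => g (x + n.+1%:R^-1 *: delta_mx ord0 j))).
  split; first exact: measurable_row_of_shift.
  by have [B' _ hB'] := piecewise_tame_bounded pm gP; exists B'.
have iD := integrableB mD i1 i0.
rewrite -[LHS]fineK; last first.
  apply: integrable_fin_num => //; exact: (integrableZl mD n.+1%:R iD).
congr EFin; rewrite -/(Rintegral _ _ (fun t => diffq j g n (row_of t))).
rewrite /diffq RintegralZl// RintegralB// integral_torus_shift ?subrr ?mulr0//.
by rewrite invr_ge0 ler0n invf_le1 ?ltr0n// ler1n.
Qed.

End Integration_by_parts.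

(** * Linearity, positivity and integration by parts for [int_Omega] *)

Section Integrals_over_regular_points.
Context {R : realType} {d : nat} (I : finType) (K : I -> 'M[R]_(d.+1, d)) (h : R).
Hypothesis pm : periodic_mesh K h.
Local Notation mR := (measurableTypeR R).
Local Notation D := (@row_of R d @^-1` regular K).
Local Notation PW := (piecewise_tame K).
Local Notation bmeasurable := (bmeasurable K).
Implicit Types (f g : 'rV[R]_d -> R).

Definition integrable_regular g : Prop :=
  (@leb R d).-integrable D (fun t => (g (row_of t))%:E).
Local Notation Jint := integrable_regular.

Let mD : measurable D := measurable_regular pm.

Let bmeasurable_part g j : PW g -> bmeasurable (partial j g).
Proof. exact: (bmeasurable_partial pm). Qed.

Let bmeasurable_tame g : PW g -> bmeasurable g.
Proof. exact: (bmeasurable_piecewise_tame pm). Qed.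

Lemma integrable_Omega_regular g : integrable_Omega g -> Jint g.
Proof.
rewrite /integrable_Omega -tcubeE; apply: integrableS => //.
- exact: measurable_tcube.
- exact: regular_preimage_sub.
Qed.

Lemma eq_int_Omega f g : (forall x, regular K x -> f x = g x) ->
  int_Omega f = int_Omega g.
Proof.
move=> fg; rewrite !(int_OmegaE pm); apply: eq_Rintegral => t; rewrite inE => Dt.
by rewrite fg.
Qed.

Lemma integrable_regularD f g : Jint f -> Jint g -> Jint (fun x => f x + g x).
Proof. by move=> jf jg; exact: (integrableD mD jf jg). Qed.

Lemma integrable_regularZ (c : R) f : Jint f -> Jint (fun x => c * f x).
Proof. by move=> jf; exact: (integrableZl mD c jf). Qed.

Lemma integrable_regularB f g : Jint f -> Jint g -> Jint (fun x => f x - g x).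
Proof. by move=> jf jg; exact: (integrableB mD jf jg). Qed.

Lemma integrable_regular_sum (J : Type) (s : seq J) (P : pred J) (f : J -> 'rV[R]_d -> R) :
  (forall i, Jint (f i)) -> Jint (fun x => \sum_(i <- s | P i) f i x).
Proof.
move=> hf; rewrite /integrable_regular.
under eq_fun do rewrite -sumEFin.
by apply: integrable_sum => // i _; exact: hf.
Qed.

Lemma int_OmegaD f g : Jint f -> Jint g ->
  int_Omega (fun x => f x + g x) = int_Omega f + int_Omega g.
Proof. by move=> ? ?; rewrite !(int_OmegaE pm) RintegralD. Qed.

Lemma int_OmegaB f g : Jint f -> Jint g ->
  int_Omega (fun x => f x - g x) = int_Omega f - int_Omega g.
Proof. by move=> ? ?; rewrite !(int_OmegaE pm) RintegralB. Qed.

Lemma int_OmegaZ c f : Jint f -> int_Omega (fun x => c * f x) = c * int_Omega f.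
Proof. by move=> ?; rewrite !(int_OmegaE pm) RintegralZl. Qed.

Lemma int_Omega_sum (J : Type) (s : seq J) (P : pred J) (f : J -> 'rV[R]_d -> R) :
  (forall i, Jint (f i)) ->
  int_Omega (fun x => \sum_(i <- s | P i) f i x) = \sum_(i <- s | P i) int_Omega (f i).
Proof.
move=> hf; elim: s => [|i s IH].
  rewrite big_nil (_ : (fun x => _) = fun x => 0 * 0); last first.
    by apply/funext => x; rewrite big_nil mulr0.
  rewrite (@int_OmegaZ 0 (fun=> 0)) ?mul0r//; exact: integrable0.
under eq_fun do rewrite big_cons; rewrite big_cons -IH.
case: (P i) => //; apply: int_OmegaD => //; exact: integrable_regular_sum.
Qed.

Lemma le_int_Omega f g : Jint f -> Jint g -> (forall x, regular K x -> f x <= g x) ->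
  int_Omega f <= int_Omega g.
Proof.
move=> jf jg fg; rewrite !(int_OmegaE pm); apply: le_Rintegral => // t Dt; exact: fg.
Qed.

Lemma int_Omega_ge0 f : (forall x, regular K x -> 0 <= f x) -> 0 <= int_Omega f.
Proof. by move=> f0; rewrite (int_OmegaE pm); apply: Rintegral_ge0 => t; exact: f0. Qed.

Lemma int_Omega_cst (c : R) : @int_Omega R d (fun=> c) = c.
Proof.
rewrite /int_Omega -tcubeE Rintegral_cst; last exact: measurable_tcube.
have -> : fine (@leb R d (tcube d)) = 1 by rewrite leb_tcube.
by rewrite mulr1.
Qed.

Lemma bmeasurable_cst (c : R) : bmeasurable (fun=> c).
Proof. by split=> //; exists `|c|. Qed.

Lemma bmeasurableD f g : bmeasurable f -> bmeasurable g -> bmeasurable (fun x => f x + g x).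
Proof.
move=> [mf [B hB]] [mg [C hC]]; split; first exact: measurable_funD.
by exists (B + C) => x rx; rewrite (le_trans (ler_normD _ _))// lerD ?hB ?hC.
Qed.

Lemma bmeasurableM f g : bmeasurable f -> bmeasurable g -> bmeasurable (fun x => f x * g x).
Proof.
move=> [mf [B hB]] [mg [C hC]]; split; first exact: measurable_funM.
by exists (B * C) => x rx; rewrite normrM ler_pM ?hB ?hC.
Qed.

Lemma bmeasurableB f g : bmeasurable f -> bmeasurable g -> bmeasurable (fun x => f x - g x).
Proof.
move=> nf ng; have := bmeasurableD nf (bmeasurableM (bmeasurable_cst (-1)) ng).
by under eq_fun do rewrite mulN1r.
Qed.

Lemma bmeasurable_sum (J : Type) (s : seq J) (P : pred J) (f : J -> 'rV[R]_d -> R) :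
  (forall i, bmeasurable (f i)) -> bmeasurable (fun x => \sum_(i <- s | P i) f i x).
Proof.
move=> hp; elim: s => [|i s IH].
  by under eq_fun do rewrite big_nil; exact: bmeasurable_cst.
under eq_fun do rewrite big_cons.
by case: (P i) => //; exact: bmeasurableD.
Qed.

Lemma bmeasurable_integrable_regular g : bmeasurable g -> Jint g.
Proof. by move=> ng; exact: (bmeasurable_integrable pm ng). Qed.

Lemma bmeasurable_frob p q (F G : 'rV[R]_d -> 'M[R]_(p, q)) :
  (forall i j, bmeasurable (fun x => F x i j)) -> (forall i j, bmeasurable (fun x => G x i j)) ->
  bmeasurable (fun x => frob (F x) (G x)).
Proof.
by move=> nF nG; apply: bmeasurable_sum => i; apply: bmeasurable_sum => j; exact: bmeasurableM.
Qed.

Lemma partialM g1 g2 j x : PW g1 -> PW g2 -> regular K x ->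
  partial j (fun y => g1 y * g2 y) x = partial j g1 x * g2 x + g1 x * partial j g2 x.
Proof.
move=> P1 P2 rx; rewrite /partial.
have d1 := @piecewise_tame_derivable _ _ _ _ _ pm g1 x (delta_mx ord0 j) P1 rx.
have d2 := @piecewise_tame_derivable _ _ _ _ _ pm g2 x (delta_mx ord0 j) P2 rx.
by rewrite (deriveM d1 d2) addrC /GRing.scale /= (mulrC (g2 x)).
Qed.

Lemma partial_lin g1 g2 (c : R) j x : PW g1 -> PW g2 -> regular K x ->
  partial j (fun y => g1 y - c * g2 y) x = partial j g1 x - c * partial j g2 x.
Proof.
move=> P1 P2 rx; rewrite /partial.
have d1 := @piecewise_tame_derivable _ _ _ _ _ pm g1 x (delta_mx ord0 j) P1 rx.
have d2 := @piecewise_tame_derivable _ _ _ _ _ pm g2 x (delta_mx ord0 j) P2 rx.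
by rewrite (deriveB d1 (derivableZ (k := c) d2)) deriveZ.
Qed.

Lemma int_partialM g1 g2 j : PW g1 -> PW g2 ->
  int_Omega (fun x => partial j g1 x * g2 x) = - int_Omega (fun x => g1 x * partial j g2 x).
Proof.
move=> P1 P2; apply/eqP; rewrite -addr_eq0 -int_OmegaD.
- rewrite -[X in _ == X](int_partial pm j (piecewise_tameM P1 P2)); apply/eqP.
  by apply: eq_int_Omega => x rx; rewrite partialM.
- by apply/bmeasurable_integrable_regular/bmeasurableM; [exact: bmeasurable_part|exact: bmeasurable_tame].
- by apply/bmeasurable_integrable_regular/bmeasurableM; [exact: bmeasurable_tame|exact: bmeasurable_part].
Qed.

Lemma divergence_by_parts (v : 'rV[R]_d -> 'rV[R]_d) g :
  (forall j, PW (fun x => v x ord0 j)) -> PW g ->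
  ip (dive v) g = - ipm v (grad g).
Proof.
move=> Pv Pg; rewrite /ip /ipm /dive /frob.
under eq_fun do rewrite mulr_suml.
rewrite int_Omega_sum; last first.
  move=> j; apply/bmeasurable_integrable_regular/bmeasurableM; [exact: bmeasurable_part|exact: bmeasurable_tame].
under [in RHS]eq_fun do rewrite big_ord1.
rewrite int_Omega_sum; last first.
  move=> j; apply/bmeasurable_integrable_regular/bmeasurableM; first exact: bmeasurable_tame.
  by under eq_fun do rewrite mxE; exact: bmeasurable_part.
rewrite -sumrN; apply: eq_bigr => j _.
rewrite int_partialM//; congr (- int_Omega _); apply/funext => x; by rewrite mxE.
Qed.

(** The square vanishes almost everywhere, whereas by continuity a nonzero value would persist on a
    box of positive measure. *)
Lemma int_sqr_eq0 g : PW g -> int_Omega (fun x => g x * g x) = 0 ->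
  forall x, Omega x -> g x = 0.
Proof.
move=> Pg i0 x0 Ox0; apply/eqP; apply/negP => /negP gx0.
have [_ cg _] := Pg.
have mg E : measurable_fun E (fun t : d.-tuple mR => g (row_of t)).
  by have := @measurable_row_of_shift _ _ g 0 E cg; under eq_fun do rewrite addr0.
have [B _ hB] := piecewise_tame_bounded pm Pg.
have mC := @measurable_tcube R d.
have ig : (@leb R d).-integrable (tcube d) (fun t => (g (row_of t) * g (row_of t))%:E).
  have C1 : (@leb R d (tcube d) < +oo)%E by rewrite leb_tcube ltry.
  apply: (measurable_bounded_integrable mC C1).
  - exact: measurable_funM.
  - exists (B * B); split; first by rewrite num_real.
    by move=> b Bb t _; rewrite /= normrM (le_trans _ (ltW Bb))// ler_pM.
have i0' : (\int[@leb R d]_(t in tcube d) `|(g (row_of t) * g (row_of t))%:E| = 0)%E.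
  have <- : (\int[@leb R d]_(t in tcube d) (g (row_of t) * g (row_of t))%:E = 0)%E.
    rewrite -[LHS]fineK; last exact: integrable_fin_num.
    by congr EFin; rewrite -[RHS]i0 /int_Omega -tcubeE.
  by apply: eq_integral => t _; rewrite gee0_abs// lee_fin -expr2 sqr_ge0.
have /ae_eq_integral_abs := i0'.
move=> /(_ mC (measurable_int _ ig)) [N [mN N0 subN]].
have gn : \forall x \near x0, g x != 0.
  by apply: (cg x0 [set z | z != 0]); apply: open_nbhs_nbhs; split; first exact: open_neq.
have /nbhs_ballP[e /= e0 he] := gn.
(* Balls are cubes for the max norm, so the ball around [x0] meets the unit cube in the open box
   with these bounds. *)
pose a j := Num.max 0 (x0 ord0 j - e); pose b j := Num.min 1 (x0 ord0 j + e).
have ab j : a j < b j.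
  rewrite /a /b gt_max !lt_min; have /andP[h1 h2] := Ox0 j.
  by rewrite ltr01 /= !addr_gt0//= ltrBlDr ltr_pwDr//=; lra.
have [mB B0] := leb_box_gt0 ab.
have : (@leb R d [set t | forall j, a j < tnth t j < b j]%R <= @leb R d N)%E.
  apply: le_measure; rewrite ?inE// => t /= tB; apply: subN => /= h0.
  have tx j : 0 < tnth t j < 1 /\ `|x0 ord0 j - tnth t j| < e.
    have /andP[] := tB j; rewrite /a /b gt_max lt_min => /andP[t0 t1] /andP[t2 t3].
    by rewrite t0 t2; split=> //; rewrite ltr_norml; apply/andP; split; lra.
  have : g (row_of t) != 0.
    apply: he; split=> // i j; rewrite (ord1 i) /ball /= mxE; exact: (tx j).2.
  have := h0 (fun j => (tx j).1); move=> [] /eqP.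
  by rewrite mulf_eq0 orbb => ->.
by rewrite N0 leNgt B0.
Qed.

End Integrals_over_regular_points.

(** * Convexity, tangents and bounds for the internal energy density *)

Section Energy_density.
Context {R : realType} {N : nat}.
Implicit Types (f g : 'rV[R]_N -> R) (r s w : 'rV[R]_N).
Local Notation orthant := (@orthant R N).
Local Notation open_orthant := (@open_orthant R N).

Lemma open_orthant_orthant r : open_orthant r -> orthant r.
Proof. by move=> h i; exact: ltW. Qed.

Lemma near_open_orthant r : open_orthant r -> \forall s \near r, open_orthant s.
Proof.
move=> r0.
have near_pos (i : 'I_N) : \forall s \near r, 0 < (s : 'rV[R]_N) ord0 i.
  have := @coord_continuous _ 1 N ord0 i r.
  by move=> /(_ [set z | 0 < z]); apply; exact: lt_nbhsr.
exact: (@filter_forall _ _ _ (nbhs r) _ near_pos).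
Qed.

Lemma derive_partial g r w : differentiable g r ->
  'D_w g r = \sum_i partial i g r * w ord0 i.
Proof.
move=> dg; rewrite deriveE// {1}(row_sum_delta w) linear_sum; apply: eq_bigr => i _.
by rewrite linearZ /= /partial deriveE// mulrC.
Qed.

(** Difference quotients of a convex function from [r] towards [s] stay below [f s - f r], hence so
    does the derivative at [r]. Differentiability is carried by [g], since [f] may be a smooth
    function only on the orthant, with arbitrary values outside. *)
Lemma convex_tangent f g r s : convex_function orthant f ->
  open_orthant r -> orthant s -> differentiable g r -> {near r, f =1 g} ->
  f r - f s <= \sum_i partial i f r * (r ord0 i - s ord0 i).
Proof.
move=> cf r0 s0 dg fg.
have fgD w : 'D_w f r = 'D_w g r by exact: near_eq_derive.
have df w : derivable f r w.
  apply: (@near_eq_derivable _ _ _ g); last exact: diff_derivable.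
  by apply: filterS fg => y ->.
suff : 'D_(s - r) f r <= f s - f r.
  rewrite fgD derive_partial// -lerN2 opprB => /le_trans; apply.
  rewrite -sumrN le_eqVlt; apply/orP; left; apply/eqP; apply: eq_bigr => i _.
  by rewrite /partial -fgD !mxE -mulrN opprB.
rewrite -(cvg_lim _ (cvg_derive_seq (df _)))//; apply: limr_le.
  by apply/cvg_ex; eexists; exact: cvg_derive_seq.
apply: nearW => n.
have n0 : 0 < n.+1%:R :> R by rewrite ltr0n.
have t0 : 0 <= n.+1%:R^-1 :> R by rewrite invr_ge0 ltW.
have t1 : n.+1%:R^-1 <= 1 :> R by rewrite invf_le1// ler1n.
have h : f (n.+1%:R^-1 *: s + (1 - n.+1%:R^-1) *: r) <=
    n.+1%:R^-1 * f s + (1 - n.+1%:R^-1) * f r.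
  exact: (cf (Itv01 t0 t1) s r (mem_set s0) (mem_set (open_orthant_orthant r0))).
rewrite mulrC -ler_pdivlMr// mulrC.
have -> : r + n.+1%:R^-1 *: (s - r) = n.+1%:R^-1 *: s + (1 - n.+1%:R^-1) *: r.
  by rewrite scalerBr scalerBl scale1r addrCA.
rewrite lerBlDr (le_trans h)// le_eqVlt; apply/orP; left; apply/eqP; ring.
Qed.

Definition energy_linear f : Prop := exists a : 'I_N -> R,
  forall r, orthant r -> f r = \sum_i a i * r ord0 i.

(** By homogeneity the difference quotients at the origin along [r] are constantly [f r]. So [f r]
    is the derivative at 0, in direction [r], of the smooth extension, and this is linear in [r]. *)
Lemma smooth_homogeneous_linear f :
  (forall (l : R) r, 0 < l -> orthant r -> f (l *: r) = l * f r) ->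
  smooth_on_orthant f -> energy_linear f.
Proof.
move=> hom [g [sg fg]].
have dg r : differentiable g r by exact: (sg [::]).
have O0 : orthant 0 by move=> i; rewrite mxE.
have f0 : f 0 = 0.
  have := hom 2 0 ltac:(by []) O0; rewrite scaler0; lra.
exists (fun i => partial i g 0) => r r0.
rewrite -derive_partial; last exact: dg.
have := cvg_derive_seq (diff_derivable (v := r) (dg 0)) => cv.
rewrite -(cvg_lim _ cv)// (_ : (fun n => _) = cst (f r)) ?lim_cst//.
apply/funext => n /=; have n0 : 0 < n.+1%:R^-1 :> R by rewrite invr_gt0 ltr0n.
rewrite add0r -!fg ?inE// ?f0 ?subr0; last first.
  by move=> i; rewrite mxE mulr_ge0// ltW.
by rewrite hom// mulVKf// pnatr_eq0.
Qed.

(** What both alternatives of [internal_energy] have in common; the energy estimates rely on these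
    three properties only. *)
Lemma internal_energyP f : internal_energy f ->
  [/\ {within orthant, continuous f}, convex_function orthant f &
    forall r, open_orthant r -> exists2 g, differentiable g r & {near r, f =1 g}].
Proof.
move=> [hom [sf|[sf cf xf]]]; last first.
  split=> // r r0; exists f; first exact: (sf [::] r r0).
  by near=> s.
have [a fE] := smooth_homogeneous_linear hom sf.
have [g [sg fg]] := sf.
split.
- apply/subspace_continuousP => r r0.
  have cg : g x @[x --> r] --> f r.
    by rewrite fg ?inE//; apply: differentiable_continuous; exact: (sg [::]).
  move=> A /cg hA; suff : \forall s \near r, orthant s -> A (f s) by [].
  have {}hA : \forall s \near r, A (g s) by exact: hA.
  by apply: filterS hA => s gs s0; rewrite fg ?inE.
- move=> t x y; rewrite !inE => x0 y0.
  suff : f (t%:num *: x + (1 - t%:num) *: y) <= t%:num * f x + (1 - t%:num) * f y by [].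
  have O : orthant (t%:num *: x + (1 - t%:num) *: y).
    move=> i; rewrite !mxE addr_ge0// mulr_ge0// ?subr_ge0//.
  rewrite !fE// !mulr_sumr -big_split /= le_eqVlt; apply/orP; left; apply/eqP.
  by apply: eq_bigr => i _; rewrite !mxE; ring.
- move=> r r0; exists g; first exact: (sg [::]).
  by apply: filterS (near_open_orthant r0) => s s0; rewrite fg// inE; exact: open_orthant_orthant.
Unshelve. all: end_near. Qed.

(** With nonnegative entries the constraint confines [r] to the compact box with sides
    [[0, 1 / V i]], on which [f] is continuous. *)
Lemma energy_bounded f (V : 'I_N -> R) : (forall i, 0 < V i) ->
  {within orthant, continuous f} ->
  exists2 C, 0 <= C & forall r, orthant r -> \sum_i V i * r ord0 i = 1 -> `|f r| <= C.
Proof.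
move=> V0 cf.
pose A : set 'rV[R]_N := [set r | forall i, `[0, (V i)^-1]%classic (r ord0 i)].
have cA : compact A by apply: (@rV_compact _ N (fun i => `[0, (V i)^-1]%classic)) => i; exact: segment_compact.
have AO : A `<=` orthant by move=> r Ar i; have := Ar i; rewrite /= in_itv /= => /andP[].
have cfA := continuous_subspaceW AO cf.
have /compact_bounded[M [_ hM]] := continuous_compact cfA cA.
exists (`|M| + 1) => // r r0 rV1; apply: (hM (`|M| + 1)).
  by rewrite (le_lt_trans (ler_norm M))// ltrDl.
exists r => // i /=; rewrite in_itv /= r0 /= -[leRHS]mul1r ler_pdivlMr// mulrC.
by rewrite -rV1 (bigD1 i)//= lerDl; apply: sumr_ge0 => k _; rewrite mulr_ge0// ltW.
Qed.

End Energy_density.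

(** * One time step: volume constraint and energy inequality *)

Lemma frob_row {R : realType} n (a b : 'rV[R]_n) :
  frob a b = \sum_j a ord0 j * b ord0 j.
Proof. by rewrite /frob big_ord1. Qed.

Lemma frob_ge0 {R : realType} m n (A : 'M[R]_(m, n)) : 0 <= frob A A.
Proof. by apply: sumr_ge0 => i _; apply: sumr_ge0 => j _; rewrite -expr2 sqr_ge0. Qed.

Section Scheme_step.
Context {R : realType} {d N : nat} (I : finType) (K : I -> 'M[R]_(d.+1, d)) (h : R).
Hypothesis pm : periodic_mesh K h.
Variables (V : 'I_N -> R) (M : 'rV[R]_N -> 'M[R]_N) (f : 'rV[R]_N -> R)
  (S : 'rV[R]_N -> 'M[R]_d -> 'M[R]_d) (tau : R).
Variables (rs : 'rV[R]_d -> 'rV[R]_N) (ts : 'rV[R]_d -> R)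
    (us : 'rV[R]_d -> 'rV[R]_d)
    (r0 r1 : 'rV[R]_d -> 'rV[R]_N) (u0 u1 : 'rV[R]_d -> 'rV[R]_d)
    (mu : 'rV[R]_d -> 'rV[R]_N) (p : 'rV[R]_d -> R).
Hypotheses (tau0 : 0 < tau) (V0 : forall i, 0 < V i).
Hypothesis step : scheme_step V M f S tau K rs ts us r0 r1 u0 u1 mu p.
Hypotheses (r0P : VhNplus N K r0) (r1P : VhNplus N K r1) (u0P : Xhd K u0) (u1P : Xhd K u1)
  (muP : VhN N K mu) (pP : Qh K p).
Hypothesis vol0 : volume_constraint V r0.
Local Notation PW := (piecewise_tame K).
Local Notation bmeasurable := (bmeasurable K).
Local Notation Jint := (integrable_regular K).

Let bmeasurable_part g j : PW g -> bmeasurable (partial j g).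
Proof. exact: (bmeasurable_partial pm). Qed.
Let bmeasurable_tame g : PW g -> bmeasurable g.
Proof. exact: (bmeasurable_piecewise_tame pm). Qed.
Let Jbmeasurable g : bmeasurable g -> Jint g.
Proof. exact: (bmeasurable_integrable_regular pm). Qed.
Let FEt m g : FE K m g -> PW g.
Proof. exact: FE_piecewise_tame. Qed.

Let tr0 i : PW (fun x => r0 x ord0 i). Proof. exact: (FEt (r0P.1 i)). Qed.
Let tr1 i : PW (fun x => r1 x ord0 i). Proof. exact: (FEt (r1P.1 i)). Qed.
Let tu0 i : PW (fun x => u0 x ord0 i). Proof. exact: (FEt (u0P i)). Qed.
Let tu1 i : PW (fun x => u1 x ord0 i). Proof. exact: (FEt (u1P i)). Qed.
Let tmu i : PW (fun x => mu x ord0 i). Proof. exact: (FEt (muP i)). Qed.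
Let tp : PW p. Proof. exact: (FEt pP.1). Qed.

Let bmeasurable_grad g j : PW g -> bmeasurable (fun x => grad g x ord0 j).
Proof. by move=> tg; under eq_fun do rewrite mxE; exact: bmeasurable_part. Qed.

Let bmeasurable_r0u1 i j : bmeasurable (fun x => (r0 x ord0 i *: u1 x) ord0 j).
Proof. by under eq_fun do rewrite mxE; apply: bmeasurableM; exact: bmeasurable_tame. Qed.

Let bmeasurable_frob_row (v w : 'rV[R]_d -> 'rV[R]_d) :
  (forall j, bmeasurable (fun x => v x ord0 j)) -> (forall j, bmeasurable (fun x => w x ord0 j)) ->
  bmeasurable (fun x => frob (v x) (w x)).
Proof. by move=> nv nw; apply: bmeasurable_frob => i j; rewrite (ord1 i). Qed.

(** The constraint on [r0] makes the weights sum to one. With a test function for [g] this treats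
    the transport terms, with [p] for [g] the pressure terms. *)
Let volume_flux_split (g : 'rV[R]_d -> R) : PW g ->
  \sum_i V i * ipm (fun x => r0 x ord0 i *: u1 x) (grad g) = ipm u1 (grad g).
Proof.
move=> tg; rewrite /ipm.
under eq_bigr => i _.
  rewrite -(int_OmegaZ pm); last first.
    by apply: Jbmeasurable; apply: bmeasurable_frob_row => j; [exact: bmeasurable_r0u1|exact: bmeasurable_grad].
  over.
rewrite -(int_Omega_sum pm); last first.
  move=> i; apply: Jbmeasurable; apply: bmeasurableM; first exact: bmeasurable_cst.
  by apply: bmeasurable_frob_row => j; [exact: bmeasurable_r0u1|exact: bmeasurable_grad].
apply: (eq_int_Omega pm) => x [Ox _].
rewrite frob_row -[RHS]mul1r -(vol0 Ox) mulr_suml; apply: eq_bigr => i _.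
rewrite frob_row -mulrA; congr (_ * _); rewrite mulr_sumr; apply: eq_bigr => j _.
by rewrite mxE mulrA.
Qed.

Let JM i j psi : Vh K psi ->
  Jint (fun x => frob (M (rs x) i j *: grad (fun y => mu y ord0 j) x) (grad psi x)).
Proof. by move=> /(mobility_defined step i j) /(integrable_Omega_regular pm). Qed.

Lemma scheme_step_volume : volume_constraint V r1.
Proof.
pose g x := \sum_i V i * r1 x ord0 i - 1.
have gV : Vh K g.
  apply: FEB; last exact: FE_cst.
  by apply: FE_sum => i; apply: FEZ; exact: r1P.1.
have tg := FEt gV.
have tdiff i : PW (fun x => r1 x ord0 i - r0 x ord0 i).
  by apply: (@FEt 1); apply: FEB; [exact: r1P.1|exact: r0P.1].
suff g0 : int_Omega (fun x => g x * g x) = 0.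
  by move=> x Ox; apply/eqP; rewrite -subr_eq0; apply/eqP; exact: (int_sqr_eq0 pm tg g0).
pose m := int_Omega g; pose q x := g x - m * 1.
have qQ : Qh K q.
  split; first by apply: FEB => //; exact: FE_cst.
  rewrite /ip (_ : (fun x => _) = fun x => g x - m); last first.
    by apply/funext => x; rewrite /q /cst /= !mulr1.
  rewrite (int_OmegaB pm); [|exact/Jbmeasurable/bmeasurable_tame|exact/Jbmeasurable/bmeasurable_cst].
  by rewrite int_Omega_cst subrr.
have tc : PW (fun=> 1) by apply: (@FEt 1); exact: FE_cst.
have gradq x j : regular K x -> grad q x ord0 j = grad g x ord0 j.
  move=> rx; rewrite !mxE /q (partial_lin pm)//.
  have -> : partial j (fun=> 1 : R) x = 0 by exact: derive_cst.
  by rewrite mulr0 subr0.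
(* By parts, the pairing with [div u1] sees only the gradient, so subtracting the mean to enter [Qh]
   is harmless. *)
have divq : ip (dive u1) q = ip (dive u1) g.
  rewrite (divergence_by_parts pm tu1 (FEt qQ.1)) (divergence_by_parts pm tu1 tg).
  apply: (congr1 -%R); apply: (eq_int_Omega pm) => x rx; rewrite !frob_row.
  by apply: eq_bigr => j _; rewrite gradq.
have E4 := quasi_incompressibility step qQ.
have E4' : ip (dive u1) g = - \sum_i V i * \sum_j
    ipm (fun x => M (rs x) i j *: grad (fun y => mu y ord0 j) x) (grad g).
  rewrite -divq E4; congr (- _); apply: eq_bigr => i _; rewrite mulr_sumr.
  apply: eq_bigr => j _; rewrite /ipm -(int_OmegaZ pm); last exact: JM.
  apply: (eq_int_Omega pm) => x rx; rewrite !frob_row mulr_sumr.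
  by apply: eq_bigr => k _; rewrite gradq// !mxE !mulrA.
have E1 : tau^-1 * \sum_i V i * ip (fun x => r1 x ord0 i - r0 x ord0 i) g = 0.
  have mb i : V i * (tau^-1 * ip (fun x => r1 x ord0 i - r0 x ord0 i) g) =
      V i * ipm (fun x => r0 x ord0 i *: u1 x) (grad g)
      - V i * \sum_j ipm (fun x => M (rs x) i j *: grad (fun y => mu y ord0 j) x) (grad g).
    rewrite -mulrBr; congr (_ * _); apply/eqP.
    by rewrite -subr_eq0 opprB addrA addrAC; apply/eqP; exact: mass_balance step i g gV.
  rewrite mulr_sumr; under eq_bigr do rewrite mulrCA mb.
  rewrite sumrB volume_flux_split//; apply/eqP; rewrite subr_eq0; apply/eqP.
  by apply: oppr_inj; rewrite -(divergence_by_parts pm tu1 tg) E4'.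
have E1' : \sum_i V i * ip (fun x => r1 x ord0 i - r0 x ord0 i) g = 0.
  by apply: (mulfI (invr_neq0 (lt0r_neq0 tau0))); rewrite E1 mulr0.
(* By the constraint on [r0], [g] is the sum of the [V i * (r1 i - r0 i)], so the vanishing sum is
   the integral of [g * g]. *)
rewrite -[RHS]E1'.
under [RHS]eq_bigr => i _.
  rewrite -(int_OmegaZ pm); last by apply: Jbmeasurable; apply: bmeasurableM; exact: bmeasurable_tame.
  over.
rewrite -(int_Omega_sum pm); last first.
  by move=> i; apply: Jbmeasurable; apply: bmeasurableM; [exact: bmeasurable_cst|apply: bmeasurableM; exact: bmeasurable_tame].
apply: (eq_int_Omega pm) => x [Ox _].
under eq_bigr do rewrite mulrA (mulrBr (V _)).
by rewrite -mulr_suml sumrB (vol0 Ox).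
Qed.

Hypotheses (fP : internal_energy f) (MP : mobility M).
Hypothesis rsP : forall x, Omega x -> orthant (rs x).
Variable cS : R.
Hypothesis SP : forall r (A : 'M[R]_d), orthant r -> cS * frob A A <= frob (S r A) A.

Let r0_gt0 x : Omega x -> open_orthant (r0 x).
Proof. by move=> Ox i; exact: r0P.2. Qed.
Let r1_gt0 x : Omega x -> open_orthant (r1 x).
Proof. by move=> Ox i; exact: r1P.2. Qed.

Lemma bmeasurable_energy_density r : VhNplus N K r -> volume_constraint V r -> bmeasurable (fun x => f (r x)).
Proof.
move=> [rV rpos] vr; have [cf _ _] := internal_energyP fP; split.
  apply: (@measurable_comp_orthant _ _ _ _ _ (fun t => r (row_of t)) f) => //.
    by move=> i; have [] := bmeasurable_tame (FEt (rV i)).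
  by move=> t [Ot _] i; apply/ltW/rpos.
have [C C0 hC] := energy_bounded V0 cf.
by exists C => x [Ox _]; apply: hC => [i|]; [exact/ltW/rpos|exact: vr].
Qed.

Lemma scheme_step_dissipation :
  0 <= \sum_i \sum_j ipm (fun x => M (rs x) i j *: grad (fun y => mu y ord0 j) x)
                         (grad (fun y => mu y ord0 i)).
Proof.
have JMmu i j := JM i j (muP i).
under eq_bigr => i _.
  rewrite /ipm -(int_Omega_sum pm); last exact: JMmu.
  over.
rewrite -(int_Omega_sum pm) => [|i]; last exact: (integrable_regular_sum pm).
apply: (int_Omega_ge0 pm) => x [Ox _].
have [_ psd _] := MP (rsP Ox).
under eq_bigr do under eq_bigr do rewrite frob_row.
under eq_bigr do rewrite exchange_big /=.
rewrite exchange_big /=; apply: sumr_ge0 => k _.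
(* In each space direction [k] the integrand is the quadratic form of [M (rs x)] at the vector of
   [k]-th derivatives of the potentials. *)
pose y : 'cV[R]_N := \col_i partial k (fun y => mu y ord0 i) x.
apply: le_trans (psd y) _; rewrite le_eqVlt; apply/orP; left; apply/eqP.
rewrite mxE exchange_big /=; apply: eq_bigr => j _.
rewrite mxE mulr_suml; apply: eq_bigr => i _; rewrite !mxE; ring.
Qed.

Lemma scheme_step_energy :
  energy f r1 u1 + tau * (cS * L2sq (Grad u1)) <= energy f r0 u0.
Proof.
have vol1 := scheme_step_volume.
have [_ cvf gf] := internal_energyP fP.
(* [X] is the exchange between internal and kinetic energy: it enters the mass and the momentum
   balance with opposite signs and cancels in [total]. *)
pose X i := ipm (fun x => r0 x ord0 i *: u1 x) (grad (fun y => mu y ord0 i)).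
pose B i := ip (fun x => r1 x ord0 i - r0 x ord0 i) (fun x => mu x ord0 i).
pose Q := \sum_i \sum_j ipm (fun x => M (rs x) i j *: grad (fun y => mu y ord0 j) x)
                         (grad (fun y => mu y ord0 i)).
pose A1 := ipm (fun x => (total_density r1 x - total_density r0 x) *: u1 x) u1.
pose A2 := ipm (fun x => total_density r0 x *: (u1 x - u0 x)) u1.
pose Sg := ipm (fun x => S (rs x) (Grad u1 x)) (Grad u1).
have Q0 : 0 <= Q := scheme_step_dissipation.
have nu0 j : bmeasurable (fun x => u0 x ord0 j) by exact: bmeasurable_tame.
have nu1 j : bmeasurable (fun x => u1 x ord0 j) by exact: bmeasurable_tame.
have nt0 : bmeasurable (total_density r0) by apply: bmeasurable_sum => i; exact: bmeasurable_tame.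
have nt1 : bmeasurable (total_density r1) by apply: bmeasurable_sum => i; exact: bmeasurable_tame.
have mass : tau^-1 * \sum_i B i - \sum_i X i + Q = 0.
  rewrite mulr_sumr -sumrB -big_split /= big1// => i _.
  exact: mass_balance step i _ (muP i).
(* As [sum_i V i * r0 i = 1], the pressure part is [- <grad p, u1> - <p, div u1>],
   which vanishes by parts. *)
have pressure : \sum_i ipm (fun x => r0 x ord0 i *:
      grad (fun y => mu y ord0 i - V i * p y) x) u1 - ip p (dive u1) = \sum_i X i.
  have -> : ip p (dive u1) = - ipm u1 (grad p).
    rewrite -(divergence_by_parts pm tu1 tp) /ip.
    by under eq_fun do rewrite mulrC.
  rewrite opprK -volume_flux_split// -big_split /=; apply: eq_bigr => i _.
  have nX g : PW g -> bmeasurable (fun x => frob (r0 x ord0 i *: u1 x) (grad g x)).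
    by move=> tg; apply: bmeasurable_frob_row => j; [exact: bmeasurable_r0u1|exact: bmeasurable_grad].
  have dec x : regular K x -> frob (r0 x ord0 i *: grad (fun y => mu y ord0 i - V i * p y) x) (u1 x)
      = frob (r0 x ord0 i *: u1 x) (grad (fun y => mu y ord0 i) x)
        - V i * frob (r0 x ord0 i *: u1 x) (grad p x).
    move=> rx; rewrite !frob_row mulr_sumr -sumrB; apply: eq_bigr => j _.
    by rewrite !mxE (partial_lin pm _ _ (tmu i) tp rx); ring.
  rewrite /ipm (eq_int_Omega pm dec) (int_OmegaB pm).
  - by rewrite (int_OmegaZ pm) ?subrK//; apply/Jbmeasurable/nX.
  - exact/Jbmeasurable/nX.
  - by apply/Jbmeasurable/bmeasurableM; [exact: bmeasurable_cst|exact: nX].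
(* The skew form vanishes because its last two arguments are both [u1]. *)
have momentum : tau^-1 * (2^-1 * A1 + A2) + Sg + \sum_i X i = 0.
  rewrite -pressure -[RHS](momentum_balance step u1P) /b_skw subrr mulr0 addr0.
  rewrite -/A1 -/A2 -/Sg invfM; ring.
have total : 2^-1 * A1 + A2 + \sum_i B i = - tau * (Sg + Q).
  have tn : tau != 0 by rewrite gt_eqF.
  apply: (mulfI (invr_neq0 tn)); rewrite mulNr mulrN mulrA mulVf// mul1r.
  by move: mass momentum; rewrite mulrDr; lra.
have SgE : cS * L2sq (Grad u1) <= Sg.
  have nG i j : bmeasurable (fun x => Grad u1 x i j).
    by under eq_fun do rewrite mxE; exact: bmeasurable_part.
  have JG : Jint (fun x => frob (Grad u1 x) (Grad u1 x)) by apply/Jbmeasurable/bmeasurable_frob.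
  rewrite /L2sq /ipm -(int_OmegaZ pm)//; apply: (le_int_Omega pm).
  - exact: (integrable_regularZ pm).
  - by apply: (integrable_Omega_regular pm); exact: stress_defined step _ u1P.
  - by move=> x [Ox _]; apply: SP; exact: rsP.
pose df i x := partial i f (r1 x) * (r1 x ord0 i - r0 x ord0 i).
have diffV i : Vh K (fun x => r1 x ord0 i - r0 x ord0 i).
  by apply: FEB; [exact: r1P.1|exact: r0P.1].
have Jdf i : Jint (df i).
  by apply: (integrable_Omega_regular pm); exact: potential_defined step i _ (diffV i).
have ndiff i : bmeasurable (fun x => r1 x ord0 i - r0 x ord0 i) by exact/bmeasurable_tame/FEt/diffV.
(* The pressure does not contribute: [sum_i V i (r1 i - r0 i) = 0]. *)
have BE : \sum_i B i = int_Omega (fun x => \sum_i df i x).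
  have Bi i : B i = int_Omega (df i) +
      int_Omega (fun x => V i * (p x * (r1 x ord0 i - r0 x ord0 i))).
    rewrite -(int_OmegaD pm) => [|//|]; last first.
      by apply/Jbmeasurable/bmeasurableM; [exact: bmeasurable_cst|apply: bmeasurableM; [exact: bmeasurable_tame|exact: ndiff]].
    have := chemical_potential step i (diffV i) => /eqP; rewrite subr_eq0 => /eqP E.
    rewrite /B /ip; under eq_fun do rewrite mulrC.
    rewrite -/(ip (fun x => mu x ord0 i) (fun x => r1 x ord0 i - r0 x ord0 i)) E /ip.
    by congr int_Omega; apply/funext => x; rewrite /df mulrDl mulrA.
  under eq_bigr do rewrite Bi.
  rewrite big_split /= -(int_Omega_sum pm)// -[RHS]addr0; congr (_ + _).
  rewrite -(int_Omega_sum pm) => [|i]; last first.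
    by apply/Jbmeasurable/bmeasurableM; [exact: bmeasurable_cst|apply: bmeasurableM; [exact: bmeasurable_tame|exact: ndiff]].
  rewrite -[RHS](@int_Omega_cst _ d 0); apply: (eq_int_Omega pm) => x [Ox _].
  under eq_bigr do rewrite mulrCA mulrBr.
  by rewrite -mulr_sumr sumrB (vol0 Ox) (vol1 _ Ox) subrr mulr0.
have nkin (r : 'rV[R]_d -> 'rV[R]_N) (u : 'rV[R]_d -> 'rV[R]_d) : bmeasurable (total_density r) -> (forall j, bmeasurable (fun x => u x ord0 j)) ->
    bmeasurable (fun x => 2^-1 * total_density r x * frob (u x) (u x)).
  move=> nr nu; apply: bmeasurableM; last exact: bmeasurable_frob_row.
  by apply: bmeasurableM => //; exact: bmeasurable_cst.
have JA1 : Jint (fun x => frob ((total_density r1 x - total_density r0 x) *: u1 x) (u1 x)).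
  apply/Jbmeasurable/bmeasurable_frob_row => // j; under eq_fun do rewrite mxE.
  by apply: bmeasurableM => //; exact: bmeasurableB.
have JA2 : Jint (fun x => frob (total_density r0 x *: (u1 x - u0 x)) (u1 x)).
  apply/Jbmeasurable/bmeasurable_frob_row => // j; under eq_fun do rewrite !mxE.
  by apply: bmeasurableM => //; exact: bmeasurableB.
(* The scheme terms dominate the energy increment: [A1] and [A2] its kinetic part up to a square,
   [B] its internal part by convexity. Both comparisons are pointwise. *)
suff : energy f r1 u1 - energy f r0 u0 <= 2^-1 * A1 + A2 + \sum_i B i.
  rewrite total => le; have : tau * (cS * L2sq (Grad u1)) <= tau * (Sg + Q).
    by apply: ler_wpM2l; [exact: ltW|apply: (le_trans SgE); rewrite lerDl].
  by move: le; rewrite mulNr; lra.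
rewrite BE /energy /A1 /A2 /ipm -(int_OmegaZ pm)//.
have J1 : Jint (fun x => 2^-1 * total_density r1 x * frob (u1 x) (u1 x) + f (r1 x)).
  by apply/Jbmeasurable/bmeasurableD; [exact: nkin|exact: bmeasurable_energy_density].
have J0 : Jint (fun x => 2^-1 * total_density r0 x * frob (u0 x) (u0 x) + f (r0 x)).
  by apply/Jbmeasurable/bmeasurableD; [exact: nkin|exact: bmeasurable_energy_density].
have JZ := integrable_regularZ pm 2^-1 JA1.
have Jsum := integrable_regular_sum pm (index_enum 'I_N) predT Jdf.
rewrite -(int_OmegaB pm J1 J0) -(int_OmegaD pm JZ JA2).
rewrite -(int_OmegaD pm (integrable_regularD pm JZ JA2) Jsum).
apply: (le_int_Omega pm).
- exact: (integrable_regularB pm).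
- by apply: (integrable_regularD pm) => //; exact: (integrable_regularD pm).
move=> x [Ox _].
(* The scheme evaluates the derivatives of [f] at the new density [r1], so the tangent is taken
   there; positivity in [VhNplus] puts [r1 x] in the open orthant. *)
have [g dg fg] := gf _ (r1_gt0 Ox).
have tang := convex_tangent cvf (r1_gt0 Ox) (open_orthant_orthant (r0_gt0 Ox)) dg fg.
(* The difference of the two sides is [total_density r0 / 2 * |u1 - u0|^2]. *)
have kin : 2^-1 * total_density r1 x * frob (u1 x) (u1 x)
      - 2^-1 * total_density r0 x * frob (u0 x) (u0 x)
    <= 2^-1 * frob ((total_density r1 x - total_density r0 x) *: u1 x) (u1 x)
       + frob (total_density r0 x *: (u1 x - u0 x)) (u1 x).
  have td0 : 0 <= total_density r0 x by apply: sumr_ge0 => i _; exact/ltW/r0_gt0.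
  move: (total_density r1 x) (total_density r0 x) td0 => a b td0.
  rewrite !frob_row !mulr_sumr -sumrB -big_split /=; apply: ler_sum => j _.
  rewrite !mxE -subr_ge0.
  have := mulr_ge0 td0 (sqr_ge0 (u1 x ord0 j - u0 x ord0 j)).
  rewrite -(pmulr_rge0 _ (_ : 0 < 2^-1)) ?invr_gt0// => /le_trans; apply.
  by rewrite le_eqVlt; apply/orP; left; apply/eqP; field.
by move: tang kin; rewrite /df; lra.
Qed.

End Scheme_step.

(** * Density bounds and control of the velocity by the energy *)

Section A_priori_bounds.
Context {R : realType} {N : nat} (hN : (0 < N)%N) (V : 'I_N -> R).
Hypothesis V0 : forall i, 0 < V i.

Lemma Vmax_ge i : V i <= Vmax hN V.
Proof. exact: le_bigmax. Qed.

Lemma Vmin_le i : Vmin hN V <= V i.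
Proof. exact: bigmin_le. Qed.

Lemma Vmin_gt0 : 0 < Vmin hN V.
Proof. exact: lt_bigmin. Qed.

Lemma Vmax_gt0 : 0 < Vmax hN V.
Proof. exact: lt_le_trans (V0 (Ordinal hN)) (Vmax_ge _). Qed.

Lemma volume_bounds (r : 'rV[R]_N) : orthant r -> \sum_i V i * r ord0 i = 1 ->
  (forall i, r ord0 i <= (V i)^-1) /\
  (Vmax hN V)^-1 <= \sum_i r ord0 i <= (Vmin hN V)^-1.
Proof.
move=> r0 rV; split=> [i|].
  rewrite -[leRHS]mul1r ler_pdivlMr// mulrC -rV (bigD1 i)//= lerDl.
  by apply: sumr_ge0 => k _; rewrite mulr_ge0// ltW.
apply/andP; split.
  rewrite -[leLHS]mul1r ler_pdivrMr ?Vmax_gt0// mulr_suml -rV.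
  by apply: ler_sum => i _; rewrite mulrC ler_wpM2l// Vmax_ge.
rewrite -[leRHS]mul1r ler_pdivlMr ?Vmin_gt0// mulr_suml -rV.
by apply: ler_sum => i _; rewrite [leRHS]mulrC ler_wpM2l// Vmin_le.
Qed.

Context {d : nat} (I : finType) (K : I -> 'M[R]_(d.+1, d)) (h : R).
Hypothesis pm : periodic_mesh K h.
Variables (f : 'rV[R]_N -> R) (Cf : R).
Hypothesis fP : internal_energy f.
Hypothesis hCf : forall r, orthant r -> \sum_i V i * r ord0 i = 1 -> `|f r| <= Cf.

(** Since [f] is at least [- Cf] on the constraint set, the kinetic part is at most the energy plus
    [Cf], whence the factor 2. The density is at least [1 / Vmax], so the unweighted norm costs a
    factor [Vmax]; the weighted norm contributes the 1. *)
Lemma kinetic_energy_bound (r : 'rV[R]_d -> 'rV[R]_N) (u : 'rV[R]_d -> 'rV[R]_d) :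
  VhNplus N K r -> volume_constraint V r -> Xhd K u ->
  L2sq u + L2sq (fun x => Num.sqrt (total_density r x) *: u x) <=
    (Vmax hN V + 1) * (2 * (energy f r u + Cf)).
Proof.
move=> rP vr uP.
pose k x := total_density r x * frob (u x) (u x).
have bmeasurable_u j : bmeasurable K (fun x => u x ord0 j).
  exact: (bmeasurable_piecewise_tame pm (FE_piecewise_tame (uP j))).
have bmeasurable_uu : bmeasurable K (fun x => frob (u x) (u x)).
  by apply: bmeasurable_frob => i j; rewrite (ord1 i).
have bmeasurable_td : bmeasurable K (total_density r).
  by apply: bmeasurable_sum => i; exact: (bmeasurable_piecewise_tame pm (FE_piecewise_tame (rP.1 i))).
have Jk : integrable_regular K k by apply/(bmeasurable_integrable_regular pm)/bmeasurableM.
have r0 x : Omega x -> orthant (r x) by move=> Ox i; exact/ltW/rP.2.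
have td0 x : Omega x -> 0 <= total_density r x.
  by move=> Ox; apply: sumr_ge0 => i _; exact: r0.
have sqrtE : L2sq (fun x => Num.sqrt (total_density r x) *: u x) = int_Omega k.
  apply: (eq_int_Omega pm) => x [Ox _]; rewrite /k !frob_row mulr_sumr.
  apply: eq_bigr => j _; rewrite !mxE mulrACA -expr2 sqr_sqrtr//; exact: td0.
have uE : L2sq u <= Vmax hN V * int_Omega k.
  rewrite -(int_OmegaZ pm)//; apply: (le_int_Omega pm).
  - exact: (bmeasurable_integrable_regular pm).
  - exact: (integrable_regularZ pm).
  move=> x [Ox _]; have [_ /andP[lo _]] := volume_bounds (r0 _ Ox) (vr _ Ox).
  rewrite /k mulrA -[leLHS]mul1r ler_wpM2r ?frob_ge0// mulrC.
  by rewrite -ler_pdivrMr ?Vmax_gt0// mul1r.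
have kE : int_Omega k <= 2 * (energy f r u + Cf).
  have Jf : integrable_regular K (fun x => f (r x)).
    exact: (bmeasurable_integrable_regular pm (bmeasurable_energy_density pm V0 fP rP vr)).
  have Jc : integrable_regular K (fun=> Cf) := bmeasurable_integrable_regular pm (bmeasurable_cst K Cf).
  have Jk2 : integrable_regular K (fun x => 2^-1 * total_density r x * frob (u x) (u x)).
    apply: (bmeasurable_integrable_regular pm); apply: bmeasurableM => //; apply: bmeasurableM => //.
    exact: bmeasurable_cst.
  rewrite /energy -[in leRHS](@int_Omega_cst _ d Cf).
  rewrite -(int_OmegaD pm (integrable_regularD pm Jk2 Jf) Jc).
  have J := integrable_regularD pm (integrable_regularD pm Jk2 Jf) Jc.
  rewrite -(int_OmegaZ pm 2 J); apply: (le_int_Omega pm) => //.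
    exact: (integrable_regularZ pm).
  move=> x [Ox _]; have := hCf (r0 _ Ox) (vr _ Ox); rewrite /k => /ler_normlP[fC _].
  move: (total_density r x) (frob _ _) => a b.
  have -> : 2 * (2^-1 * a * b + f (r x) + Cf) = a * b + 2 * (f (r x) + Cf) by field.
  rewrite lerDl mulr_ge0//; lra.
rewrite sqrtE (le_trans (lerD uE (lexx _)))//.
rewrite -[X in _ + X]mul1r -mulrDl ler_wpM2l// addr_ge0//.
exact/ltW/Vmax_gt0.
Qed.

End A_priori_bounds.

Theorem theorem2 (R : realType) (d N : nat) (hd : (0 < d)%N) (hN : (0 < N)%N)
    (V : 'I_N -> R) (M : 'rV[R]_N -> 'M[R]_N) (f : 'rV[R]_N -> R)
    (S : 'rV[R]_N -> 'M[R]_d -> 'M[R]_d) (T : R)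
    (hT : 0 < T) (hV : forall i, 0 < V i)
    (hM : mobility M) (hf : internal_energy f) (hS : coercive_stress S) :
  exists C : R -> R,
  forall (rho_init : 'rV[R]_d -> 'rV[R]_N) (m_init : 'rV[R]_d -> 'rV[R]_d)
    (n : nat) (I : finType) (K : I -> 'M[R]_(d.+1, d)) (h : R)
    (rstar : ('rV[R]_d -> 'rV[R]_N) -> ('rV[R]_d -> 'rV[R]_N) ->
             'rV[R]_d -> 'rV[R]_N)
    (tstar : ('rV[R]_d -> 'rV[R]_N) -> ('rV[R]_d -> 'rV[R]_N) ->
             'rV[R]_d -> R)
    (ustar : ('rV[R]_d -> 'rV[R]_d) -> ('rV[R]_d -> 'rV[R]_d) ->
             'rV[R]_d -> 'rV[R]_d)
    (rho : R -> 'rV[R]_d -> 'rV[R]_N) (u : R -> 'rV[R]_d -> 'rV[R]_d)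
    (mu : R -> 'rV[R]_d -> 'rV[R]_N) (p : R -> 'rV[R]_d -> R),
  let tau := step_size T n in
  let t := tgrid T n in
  initial_data V rho_init m_init ->
  (0 < n)%N ->
  periodic_mesh K h ->
  preserves_nonneg rstar ->
  Pi1 T n (VhNplus N K) rho ->
  Pi1 T n (Xhd K) u ->
  Pi0 T n (VhN N K) mu ->
  Pi0 T n (Qh K) p ->
  volume_constraint V (rho (t 0%N)) ->
  discrete_solution V M f S tau K T n rstar tstar ustar rho u mu p ->
  [/\ forall k x, (1 <= k <= n)%N -> Omega x ->
        \sum_i V i * rho (t k) x ord0 i = 1,
      forall k x, (1 <= k <= n)%N -> Omega x ->
        (forall i, rho (t k) x ord0 i <= (V i)^-1) /\
        (Vmax hN V)^-1 <= total_density (rho (t k)) x <= (Vmin hN V)^-1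
    & \big[Num.max/0]_(1 <= k < n.+1)
          (L2sq (u (t k)) +
           L2sq (fun x => Num.sqrt (total_density (rho (t k)) x) *: u (t k) x))
      + \sum_(1 <= k < n.+1) tau * L2sq (Grad (u (t k)))
      <= C (energy f (rho (t 0%N)) (u (t 0%N)))].
Proof.
have [cS [cS0 SP]] := hS.
have [cf _ _] := internal_energyP hf.
have [Cf Cf0 hCf] := energy_bounded hV cf.
(* The first summand bounds the maximum, the second the gradients, whose coercivity constant is
   [cS]. As [Cf] depends only on [f] and [V], and [cS] only on [S], the choice can precede the mesh,
   the time grid and the solution. *)
exists (fun E => (Vmax hN V + 1) * (2 * (E + Cf)) + (E + Cf) / cS).
move=> rho_init m_init n I K h rstar tstar ustar rho u mu p tau t _ n0 pm rsP
  [rhoP _] [uP _] muP pP vol0 sol.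
have n0R : 0 < n%:R :> R by rewrite ltr0n.
have tau0 : 0 < tau by rewrite divr_gt0.
have t01 k : (k <= n)%N -> 0 <= t k <= T.
  move=> kn; rewrite /t /tgrid mulr_ge0 ?ler0n ?(ltW tau0)//=.
  by rewrite /step_size mulrCA ler_piMr ?(ltW hT)// ler_pdivrMr// mul1r ler_nat.
have rP k : (k <= n)%N -> VhNplus N K (rho (t k)) by move=> /t01; exact: rhoP.
have uK k : (k <= n)%N -> Xhd K (u (t k)) by move=> /t01; exact: uP.
have vol k : (k <= n)%N -> volume_constraint V (rho (t k)).
  elim: k => // k IH kn.
  exact: (scheme_step_volume pm tau0 (sol k kn) (rP _ (ltnW kn)) (rP _ kn)
    (uK _ kn) (IH (ltnW kn))).
have r0 k x : (k <= n)%N -> Omega x -> orthant (rho (t k) x).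
  by move=> kn Ox i; exact/ltW/(rP k kn).2.
(* The accumulated dissipation is kept in the induction, since it becomes the gradient estimate. *)
have energy_decay k : (k <= n)%N ->
    energy f (rho (t k)) (u (t k)) + cS * \sum_(1 <= j < k.+1) tau * L2sq (Grad (u (t j)))
    <= energy f (rho (t 0%N)) (u (t 0%N)).
  elim: k => [|k IH] kn; first by rewrite big_geq// mulr0 addr0.
  have decay := scheme_step_energy pm tau0 hV (sol k kn) (rP _ (ltnW kn)) (rP _ kn)
    (uK _ (ltnW kn)) (uK _ kn) (muP k kn).1 (pP k kn).1 (vol _ (ltnW kn)) hf hM
    (rsP _ _ (fun x => r0 k x (ltnW kn)) (fun x => r0 k.+1 x kn)) SP.
  apply: le_trans (IH (ltnW kn)); rewrite big_nat_recr//= mulrDr.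
  by rewrite addrCA [leRHS]addrC lerD2l mulrCA.
have L2_ge0 m1 m2 (G : 'rV[R]_d -> 'M[R]_(m1, m2)) : 0 <= L2sq G.
  by apply: (int_Omega_ge0 pm) => x _; exact: frob_ge0.
have kin k : (k <= n)%N -> L2sq (u (t k)) +
    L2sq (fun x => Num.sqrt (total_density (rho (t k)) x) *: u (t k) x) <=
    (Vmax hN V + 1) * (2 * (energy f (rho (t k)) (u (t k)) + Cf)).
  by move=> kn; exact: (kinetic_energy_bound hN hV pm hf hCf (rP k kn) (vol k kn) (uK k kn)).
have Vm0 : 0 < Vmax hN V + 1 by rewrite addr_gt0// Vmax_gt0.
have sum_ge0 k : 0 <= \sum_(1 <= j < k.+1) tau * L2sq (Grad (u (t j))).
  by apply: sumr_ge0 => j _; rewrite mulr_ge0// ltW.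
split.
- by move=> k x /andP[_ kn] Ox; exact: vol.
- by move=> k x /andP[_ kn] Ox; apply: volume_bounds => //; [exact: r0|exact: vol].
have energy_le k : (k <= n)%N ->
    energy f (rho (t k)) (u (t k)) <= energy f (rho (t 0%N)) (u (t 0%N)).
  move=> kn; apply: le_trans (energy_decay k kn).
  by rewrite lerDl mulr_ge0// ltW.
(* Read off from the kinetic bound, whose left side is nonnegative; it allows the final energy to be
   dropped from the decay estimate. *)
have energy_ge k : (k <= n)%N -> 0 <= energy f (rho (t k)) (u (t k)) + Cf.
  move=> kn; have := le_trans (addr_ge0 (L2_ge0 _ _ _) (L2_ge0 _ _ _)) (kin k kn).
  by rewrite pmulr_rge0// pmulr_rge0.
apply: lerD.
  (* The maximum has default value 0, which the bound must dominate as well: this is [energy_ge] at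
     step 0. *)
  rewrite big_seq; apply: bigmax_le => [|k].
    by rewrite mulr_ge0 ?(ltW Vm0)// mulr_ge0// energy_ge.
  rewrite mem_index_iota => /andP[_ kn]; apply: (le_trans (kin k kn)).
  by rewrite ler_pM2l// ler_pM2l// lerD2r energy_le.
rewrite ler_pdivlMr// mulrC -subr_ge0.
have := energy_decay n (leqnn n); have := energy_ge n (leqnn n); lra.
Qed.
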